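(* Let $(X,\mu)$ be a $\sigma$-finite standard measure space, $K$ a compact (second countable) abelian group with Haar measure $\nu$, and $\Gamma$ a countable discrete group. Let $\alpha: \Gamma \curvearrowright (X,\mu)$ be a measure preserving action, $\beta: \Gamma \curvearrowright (K,\nu)$ an action by continuous group automorphisms, $c: \Gamma\times X\to K$ a $\beta$-cocycle for $\alpha$, and $\rho:\Gamma\curvearrowright (X\times K,\mu\times\nu)$ the associated twisted skew product action. Suppose that $\Gamma_\chi$ acts ergodically on $(X,\mu)$ (via $\alpha$) for each $\chi\in\widehat{K}$. Then the following are equivalent: 1. The twisted skew product $\rho: \Gamma\curvearrowright X\times K$ is ergodic. 2. For each non-trivial $\chi\in\widehat{K}$ with a finite $\widehat{\beta}$-orbit, the $\mathbb{T}$-valued cocycle $c_\chi$ is not a coboundary.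
   Context: A $\beta$-cocycle for $\alpha$ is a Borel map $c:\Gamma\times X\to K$ satisfying $c(h,\alpha_g(x))\,\beta_h(c(g,x)) = c(hg,x)$ for all $g,h\in\Gamma$ and a.e. $x\in X$. The associated twisted skew product action is $\rho_g(x,k) = (\alpha_g(x), c(g,x)\beta_g(k))$. The dual action $\widehat{\beta}:\Gamma\curvearrowright\widehat{K}$ on the Pontryagin dual is $(g\cdot\chi)(k) = \chi(\beta_{g^{-1}}(k))$, and $\Gamma_\chi$ is the stabilizer of $\chi\in\widehat{K}$ under $\widehat{\beta}$. The induced cocycle $c_\chi:\Gamma_\chi\times X\to\mathbb{T}$ is $c_\chi(g,x) = \chi(c(g,x))$, a genuine $1$-cocycle for $\alpha|_{\Gamma_\chi}$. It is a coboundary if there is a Borel map $f: X\to\mathbb{T}$ with $c_\chi(g,x) = f(\alpha_g(x))f(x)^{-1}$ for all $g\in\Gamma_\chi$ and a.e. $x\in X$. *)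

(* Defs.v *)
From HB Require Import structures.
From mathcomp Require Import all_boot all_order all_algebra.
From mathcomp Require Import all_classical all_reals all_analysis.
From mathcomp Require Import complex.

Set Implicit Arguments.
Unset Strict Implicit.
Unset Printing Implicit Defensive.
Import Order.TTheory GRing.Theory Num.Theory.
Import numFieldNormedType.Exports.
Local Open Scope classical_set_scope.
Local Open Scope ring_scope.
Local Open Scope complex_scope.

HB.instance Definition _ (R : realType) := PseudoPointedMetric.copy R[i] R[i]^o.

(* A topological abelian group (written additively) with its Borel
   sigma-algebra; an alias, since topologicalZmodType is not pointed. *)
Definition borel_group (K : topologicalZmodType) : Type := K.

Section borel_group_instances.
Variable K : topologicalZmodType.

HB.instance Definition _ := Choice.copy (borel_group K) K.
HB.instance Definition _ := isPointed.Build (borel_group K) (0 : K).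
HB.instance Definition _ :=
  @isMeasurable.Build (sigma_display (@open K)) (borel_group K)
    <<s @open K >> (@sigma_algebra0 _ setT (@open K))
    (@sigma_algebraC (borel_group K) (@open K))
    (@sigma_algebra_bigcup _ setT (@open K)).

End borel_group_instances.

(* The sigma-algebra of X is the Borel sigma-algebra of a Polish topology,
   transported along the bijection f. *)
Definition standard_borel (R : realType) d (X : measurableType d) : Prop :=
  exists (P : completePseudoMetricType R) (f : X -> P),
    [/\ hausdorff_space P,
        exists2 D : set P, countable D & dense D,
        bijective f &
        forall A : set X, measurable A <-> <<s @open P >> (f @` A)].

Definition haar_measure (R : realType) (K : topologicalZmodType)
    (nu : set (borel_group K) -> \bar R) : Prop :=
  nu [set: borel_group K] != 0%E /\
  forall (k : K) (A : set (borel_group K)),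
    measurable A -> nu ((fun l : K => k + l) @^-1` A) = nu A.

Section actions.
Variables (G : groupType) (T : Type).

Definition group_action (a : G -> T -> T) : Prop :=
  (forall x, a 1%g x = x) /\ (forall g h x, a (g * h)%g x = a g (a h x)).

End actions.

Definition mp_action (R : realType) (G : groupType) d (X : measurableType d)
    (mu : set X -> \bar R) (a : G -> X -> X) : Prop :=
  [/\ group_action a,
      forall g, measurable_fun [set: X] (a g) &
      forall g (A : set X), measurable A -> mu (a g @^-1` A) = mu A].

Definition automorphism_action (G : groupType) (K : topologicalZmodType)
    (b : G -> K -> K) : Prop :=
  [/\ group_action b,
      forall g, continuous (b g) &
      forall g, {morph b g : k l / k + l}].

(* Ergodicity of the maps a g with g in H.  Invariance of sets is understood
   up to null sets: the skew product below satisfies the action identities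
   only almost everywhere. *)
Definition ergodic (R : realType) (G : Type) d (X : measurableType d)
    (mu : set X -> \bar R) (a : G -> X -> X) (H : set G) : Prop :=
  forall A : set X, measurable A ->
    (forall g, H g -> {ae mu, forall x, A (a g x) <-> A x}) ->
    mu A = 0%E \/ mu (~` A) = 0%E.

Section skew_product.
Variables (G : groupType) (d : measure_display) (X : measurableType d).
Variable K : topologicalZmodType.
Variables (alpha : G -> X -> X) (beta : G -> K -> K) (c : G -> X -> K).

(* For a countable discrete group G, c is Borel on G * X iff each c g is. *)
Definition beta_cocycle (R : realType) (mu : set X -> \bar R) : Prop :=
  (forall g, measurable_fun [set: X] (c g : X -> borel_group K)) /\
  (forall g h, {ae mu, forall x,
     c h (alpha g x) + beta h (c g x) = c (h * g)%g x}).

Definition skew_product (g : G) (p : X * borel_group K) : X * borel_group K :=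
  (alpha g p.1, c g p.1 + beta g p.2).

End skew_product.

Section dual.
Variables (R : realType) (G : groupType) (K : topologicalZmodType).

(* Characters K -> T, seen as maps into R[i] with values of modulus 1. *)
Definition pontryagin_dual : set (K -> R[i]) :=
  [set chi : K -> R[i] | [/\ continuous chi,
                 forall k, `|chi k| = 1 &
                 forall k l, chi (k + l) = chi k * chi l]].

Definition dual_action (beta : G -> K -> K) (g : G) (chi : K -> R[i]) :
  K -> R[i] := fun k => chi (beta (g^-1)%g k).

Definition dual_stabilizer (beta : G -> K -> K) (chi : K -> R[i]) : set G :=
  [set g | dual_action beta g chi = chi].

Definition dual_orbit (beta : G -> K -> K) (chi : K -> R[i]) :
  set (K -> R[i]) := [set dual_action beta g chi | g in [set: G]].

End dual.

Definition induced_cocycle (R : realType) (G X K : Type)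
  (c : G -> X -> K) (chi : K -> R[i]) : G -> X -> R[i] :=
  fun g x => chi (c g x).

Definition coboundary (R : realType) (G : Type) d (X : measurableType d)
    (mu : set X -> \bar R) (alpha : G -> X -> X) (H : set G)
    (w : G -> X -> R[i]) : Prop :=
  exists f : X -> R[i],
    [/\ measurable_fun [set: X] (f : X -> g_sigma_algebraType (@open R[i])),
        forall x, `|f x| = 1 &
        forall g, H g -> {ae mu, forall x, w g x = f (alpha g x) * (f x)^-1}].

(* Main.v *)
Require Import Defs.
From mathcomp Require Import all_boot all_order all_algebra.
From mathcomp Require Import all_classical all_reals all_analysis.
From mathcomp Require Import complex.
From mathcomp Require Import measurable_realfun ring lra.
Import Order.TTheory GRing.Theory Num.Theory.
Import numFieldNormedType.Exports.
Local Open Scope classical_set_scope.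
Local Open Scope ring_scope.
Local Open Scope complex_scope.


(** The proof is Fourier analysis in the fibre direction. A bounded function
    F on X * K has, for each character chi, a coefficient
    F_chi(x), the normalised Haar integral of F(x, k) conj(chi k) over k.
    The change of variables k |-> c g x + beta g k turns invariance of F under
    the skew product into

      F_chi (alpha g x) = conj (chi (c g x)) F_(chi o beta g) (x),

    so |F_chi| is invariant under the stabiliser of chi, hence constant almost
    everywhere, with the same constant along the dual orbit of chi.

    If the skew product is ergodic and c_chi is the coboundary of f, then
    conj(f x) chi(k) is invariant under the stabiliser of chi. Summing its
    translates over the finite orbit of chi gives an invariant function, which
    must be constant; but its coefficient at the nontrivial character chi has
    modulus 1 ([no_coboundary_of_ergodic]).

    Conversely, let F be the indicator of an invariant set A and let chi be
    nontrivial. On an infinite orbit a nonzero constant |F_chi| contradicts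
    Bessel's inequality; on a finite one, normalising conj F_chi gives a
    function of which c_chi is the coboundary. So F_chi vanishes almost
    everywhere, simultaneously for all nontrivial chi because the dual is
    countable ([countable_dual]). A measurable subset of K all of whose
    nontrivial coefficients vanish is null or conull ([character_of_set]), so
    almost every fibre of A is null or conull, and ergodicity at the trivial
    character, whose stabiliser is everything, decides which one
    ([ergodic_of_no_coboundary]).

    [character_of_set] carries the Peter-Weyl theorem, and the bulk of the file
    proves it. Convolution makes the bounded measurable functions on K a
    commutative algebra with the involution u~(k) = conj (u (- k)). If w is
    Hermitian and w * w is not null, the powers of w * w, divided by those of its
    largest eigenvalue, converge uniformly to a Hermitian idempotent E, the
    projection onto the top eigenspace ([power_projection]). The square norm of
    a nonzero Hermitian idempotent is at least 1
    and drops by at least 1 on a proper subprojection, so below E there is a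
    minimal one; translations act on it by scalars, and these scalars form a
    character ([projection_character]). Applied to w = u * u~, where u is the
    centred indicator of a set that is neither null nor conull, this yields a
    character at which u has a nonzero coefficient. *)

Set Implicit Arguments.
Unset Strict Implicit.
Unset Printing Implicit Defensive.

Local Notation Re := complex.Re.
Local Notation Im := complex.Im.

(** * Complex numbers *)

Section complex_numbers.
Variable R : realType.
Implicit Types z w : R[i].

(** The squared modulus is valued in the ordered field [R], whereas the norm
    of [R[i]] is valued in [R[i]]. *)
Definition sqmod (z : R[i]) : R := Re z ^+ 2 + Im z ^+ 2.

Lemma ReD z w : Re (z + w) = Re z + Re w. Proof. by case: z w => [? ?] []. Qed.
Lemma ImD z w : Im (z + w) = Im z + Im w. Proof. by case: z w => [? ?] []. Qed.
Lemma ReN z : Re (- z) = - Re z. Proof. by case: z. Qed.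
Lemma ImN z : Im (- z) = - Im z. Proof. by case: z. Qed.
Lemma ReM z w : Re (z * w) = Re z * Re w - Im z * Im w.
Proof. by case: z w => [? ?] []. Qed.
Lemma ImM z w : Im (z * w) = Re z * Im w + Im z * Re w.
Proof. by case: z w => [? ?] []. Qed.
Lemma ReJ z : Re z^*%C = Re z. Proof. by case: z. Qed.
Lemma ImJ z : Im z^*%C = - Im z. Proof. by case: z. Qed.
Definition ReImE := (ReD, ImD, ReN, ImN, ReM, ImM, ReJ, ImJ).

Lemma conjcD z w : (z + w)^*%C = z^*%C + w^*%C. Proof. exact: rmorphD. Qed.
Lemma conjcB z w : (z - w)^*%C = z^*%C - w^*%C. Proof. exact: rmorphB. Qed.
Lemma conjcM z w : (z * w)^*%C = z^*%C * w^*%C. Proof. exact: rmorphM. Qed.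

Lemma complex_ext z w : Re z = Re w -> Im z = Im w -> z = w.
Proof. by case: z w => [a b] [c e] /= -> ->. Qed.

Lemma sqmod_ge0 z : 0 <= sqmod z.
Proof. by rewrite addr_ge0 // sqr_ge0. Qed.

Lemma sqmodM z w : sqmod (z * w) = sqmod z * sqmod w.
Proof. by rewrite /sqmod !ReImE; ring. Qed.

Lemma sqmodJ z : sqmod z^*%C = sqmod z.
Proof. by rewrite /sqmod !ReImE sqrrN. Qed.

Lemma sqmodN z : sqmod (- z) = sqmod z.
Proof. by rewrite /sqmod !ReImE !sqrrN. Qed.

Lemma sqmodB z w : sqmod (z - w) = sqmod (w - z).
Proof. by rewrite -sqmodN opprB. Qed.

Lemma mulJ z : z * z^*%C = (sqmod z)%:C.
Proof. by apply: complex_ext; rewrite !ReImE /sqmod /=; ring. Qed.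

Lemma sqmod_eq0 z : (sqmod z == 0) = (z == 0).
Proof.
rewrite /sqmod paddr_eq0 ?sqr_ge0 // !sqrf_eq0.
by case: z => a b; rewrite eq_complex.
Qed.

Lemma sqmod0 : sqmod 0 = 0 :> R.
Proof. by apply/eqP; rewrite sqmod_eq0. Qed.

Lemma sqmod1 : sqmod 1 = 1 :> R.
Proof. by rewrite /sqmod /= expr1n expr0n addr0. Qed.

Lemma sqmod_normP z : reflect (`|z| = 1) (sqmod z == 1).
Proof.
apply: (iffP eqP) => [z1|z1].
  by apply/eqP; rewrite -(@eqrXn2 _ 2) ?normr_ge0 // sqr_normc mulJ z1 expr1n.
by apply: (@complexI R); rewrite -mulJ -sqr_normc z1 expr1n.
Qed.

Lemma mulJ1 z : `|z| = 1 -> z * z^*%C = 1.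
Proof. by move/sqmod_normP/eqP => z1; rewrite mulJ z1. Qed.

Lemma Re_le_sqmod z : `|Re z| ^+ 2 <= sqmod z.
Proof. by rewrite real_normK ?num_real // lerDl sqr_ge0. Qed.

Lemma Im_le_sqmod z : `|Im z| ^+ 2 <= sqmod z.
Proof. by rewrite real_normK ?num_real // lerDr sqr_ge0. Qed.

Lemma Re_le_norm z (r : R) : `|z| <= r%:C -> `|Re z| <= r.
Proof. by move=> zr; rewrite -lecR (le_trans (normc_ge_Re z)). Qed.

Lemma normc_ge_Im z : `|Im z|%:C <= `|z|.
Proof.
have := normc_ge_Re (z * 'i%C); rewrite normrM ReM /= mulr0 mulr1 sub0r normrN.
suff -> : `|'i%C : R[i]| = 1 by rewrite mulr1.
by apply/sqmod_normP; rewrite /sqmod /= expr0n expr1n add0r.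
Qed.

Lemma Im_le_norm z (r : R) : `|z| <= r%:C -> `|Im z| <= r.
Proof. by move=> zr; rewrite -lecR (le_trans (normc_ge_Im z)). Qed.

Lemma ltc_sqmod z (r : R) : 0 <= r -> (`|z| < r%:C) = (sqmod z < r ^+ 2).
Proof.
move=> r0; rewrite -[in RHS]ltcR -mulJ -sqr_normc rmorphXn /=.
by rewrite ltr_pXn2r // nnegrE // lecR.
Qed.

End complex_numbers.

(** * Bounded measurable functions *)

Section bounded_measurable.
Variables (R : realType).

Definition bmeas d (T : measurableType d) (f : T -> R) : Prop :=
  measurable_fun [set: T] f /\ exists M, forall x, `|f x| <= M.

Definition cbmeas d (T : measurableType d) (f : T -> R[i]) : Prop :=
  bmeas (fun x => Re (f x)) /\ bmeas (fun x => Im (f x)).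

Section closure.
Context d (T : measurableType d).
Implicit Types (f g : T -> R) (u v : T -> R[i]).

Lemma bmeas_cst (r : R) : bmeas (fun _ : T => r).
Proof. by split; [exact: measurable_cst|exists `|r|]. Qed.

Lemma bmeasD f g : bmeas f -> bmeas g -> bmeas (fun x => f x + g x).
Proof.
move=> [mf [M fM]] [mg [N gN]]; split; first exact: measurable_funD.
by exists (M + N) => x; rewrite (le_trans (ler_normD _ _)) // lerD.
Qed.

Lemma bmeasN f : bmeas f -> bmeas (fun x => - f x).
Proof.
move=> [mf [M fM]]; split; first exact: measurable_funN.
by exists M => x; rewrite normrN.
Qed.

Lemma bmeasB f g : bmeas f -> bmeas g -> bmeas (fun x => f x - g x).
Proof. by move=> bf bg; apply: bmeasD => //; exact: bmeasN. Qed.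

Lemma bmeasM f g : bmeas f -> bmeas g -> bmeas (fun x => f x * g x).
Proof.
move=> [mf [M fM]] [mg [N gN]]; split; first exact: measurable_funM.
by exists (M * N) => x; rewrite normrM ler_pM.
Qed.

Lemma bmeas_indic (A : set T) : measurable A -> bmeas (\1_A : T -> R).
Proof.
move=> mA; split; first exact: measurable_indic.
by exists 1 => x; rewrite indicE ger0_norm // lern1 leq_b1.
Qed.

Lemma cbmeas_cst (r : R[i]) : cbmeas (fun _ : T => r).
Proof. by split; exact: bmeas_cst. Qed.

Lemma cbmeasD u v : cbmeas u -> cbmeas v -> cbmeas (fun x => u x + v x).
Proof.
move=> [ur ui] [vr vi]; split; under eq_fun do rewrite ReImE; exact: bmeasD.
Qed.

Lemma cbmeasN u : cbmeas u -> cbmeas (fun x => - u x).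
Proof. move=> [ur ui]; split; under eq_fun do rewrite ReImE; exact: bmeasN. Qed.

Lemma cbmeasB u v : cbmeas u -> cbmeas v -> cbmeas (fun x => u x - v x).
Proof. by move=> bu bv; apply: cbmeasD => //; exact: cbmeasN. Qed.

Lemma cbmeasM u v : cbmeas u -> cbmeas v -> cbmeas (fun x => u x * v x).
Proof.
move=> [ur ui] [vr vi]; split; under eq_fun do rewrite ReImE.
  by apply: bmeasB; exact: bmeasM.
by apply: bmeasD; exact: bmeasM.
Qed.

Lemma cbmeasJ u : cbmeas u -> cbmeas (fun x => (u x)^*%C).
Proof.
by move=> [ur ui]; split; under eq_fun do rewrite ReImE; [|exact: bmeasN].
Qed.

Lemma cbmeas_real f : bmeas f -> cbmeas (fun x => (f x)%:C).
Proof. by move=> bf; split => //; exact: bmeas_cst. Qed.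

Lemma cbmeas_sum (I : eqType) (r : seq I) (F : I -> T -> R[i]) :
  (forall i, i \in r -> cbmeas (F i)) -> cbmeas (fun x => \sum_(i <- r) F i x).
Proof.
elim: r => [|i r IHr] bF.
  by under eq_fun do rewrite big_nil; exact: cbmeas_cst.
under eq_fun do rewrite big_cons.
apply: cbmeasD; first by apply: bF; rewrite mem_head.
by apply: IHr => j jr; apply: bF; rewrite in_cons jr orbT.
Qed.

Lemma bmeas_sqmod u : cbmeas u -> bmeas (fun x => sqmod (u x)).
Proof. by move=> [ur ui]; apply: bmeasD; exact: bmeasM. Qed.

Lemma cbmeas_bound u : cbmeas u -> exists M : R, forall x, sqmod (u x) <= M.
Proof.
move=> /bmeas_sqmod[_ [M uM]]; exists M => x.
by rewrite (le_trans (ler_norm _)).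
Qed.

Lemma cbmeas_norm1 u : (forall x, `|u x| = 1) ->
  measurable_fun [set: T] (fun x => Re (u x)) ->
  measurable_fun [set: T] (fun x => Im (u x)) -> cbmeas u.
Proof.
move=> u1 mr mi; split; split => //; exists 1 => x.
  by apply: Re_le_norm; rewrite u1.
by apply: Im_le_norm; rewrite u1.
Qed.

End closure.

Lemma cbmeas_comp d d' (T : measurableType d) (T' : measurableType d')
    (h : T -> T') (u : T' -> R[i]) :
  measurable_fun [set: T] h -> cbmeas u -> cbmeas (fun x => u (h x)).
Proof.
move=> mh [[mr [M rM]] [mi [N iN]]]; split; split.
- exact: (measurableT_comp mr).
- by exists M => x.
- exact: (measurableT_comp mi).
- by exists N => x.
Qed.

Lemma bmeas_comp d d' (T : measurableType d) (T' : measurableType d')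
    (h : T -> T') (f : T' -> R) :
  measurable_fun [set: T] h -> bmeas f -> bmeas (fun x => f (h x)).
Proof.
by move=> mh [mf [M fM]]; split; [exact: (measurableT_comp mf)|exists M].
Qed.

End bounded_measurable.

(** * The normalised integral *)

Section normalised_integral.
Context (R : realType) d (Y : measurableType d).
Variable nu : {finite_measure set Y -> \bar R}.
Implicit Types (f g : Y -> R) (u v : Y -> R[i]).

Definition rmean f : R := (fine (nu [set: Y]))^-1 * (\int[nu]_y f y).

Definition mean u : R[i] :=
  rmean (fun y => Re (u y)) +i* rmean (fun y => Im (u y)).

Lemma nuT_lty : (nu [set: Y] < +oo)%E.
Proof. by rewrite ltey_eq fin_num_measure. Qed.

Lemma bmeas_integrable f : bmeas f -> nu.-integrable [set: Y] (EFin \o f).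
Proof.
move=> [mf [M fM]]; apply: measurable_bounded_integrable => //.
  exact: nuT_lty.
exists M; split; first exact: num_real.
by move=> N MN x _ /=; rewrite (le_trans (fM x)) // ltW.
Qed.
Local Hint Resolve bmeas_integrable : core.

Lemma rmeanD f g : bmeas f -> bmeas g ->
  rmean (fun y => f y + g y) = rmean f + rmean g.
Proof. by move=> bf bg; rewrite /rmean RintegralD ?mulrDr //; auto. Qed.

Lemma rmeanZ (r : R) f : bmeas f -> rmean (fun y => r * f y) = r * rmean f.
Proof. by move=> bf; rewrite /rmean RintegralZl //; [ring|auto]. Qed.

Lemma rmeanN f : bmeas f -> rmean (fun y => - f y) = - rmean f.
Proof.
move=> bf; rewrite -[RHS]mulN1r -rmeanZ //; congr rmean.
by apply/funext => y; rewrite mulN1r.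
Qed.

Lemma rmeanB f g : bmeas f -> bmeas g ->
  rmean (fun y => f y - g y) = rmean f - rmean g.
Proof. by move=> bf bg; rewrite rmeanD ?rmeanN //; exact: bmeasN. Qed.

Lemma rmean_ge0 f : (forall y, 0 <= f y) -> 0 <= rmean f.
Proof.
by move=> f0; apply: mulr_ge0; [rewrite invr_ge0 fine_ge0|exact: Rintegral_ge0].
Qed.

Lemma rmean_le f g : bmeas f -> bmeas g -> (forall y, f y <= g y) ->
  rmean f <= rmean g.
Proof.
move=> bf bg fg; rewrite -subr_ge0 -rmeanB //; apply: rmean_ge0 => y.
by rewrite subr_ge0.
Qed.

Lemma rmean_ae f g : bmeas f -> bmeas g -> {ae nu, forall y, f y = g y} ->
  rmean f = rmean g.
Proof.
move=> [mf _] [mg _] fg; congr (_ * fine _).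
apply: ae_eq_integral => //; try exact/measurable_EFinP.
by apply: filterS fg => y fgy _; congr EFin.
Qed.

Lemma meanD u v : cbmeas u -> cbmeas v ->
  mean (fun y => u y + v y) = mean u + mean v.
Proof.
move=> [ur ui] [vr vi]; apply: complex_ext; rewrite ReImE /= -rmeanD //.
  by congr rmean; apply/funext => y; rewrite ReImE.
by congr rmean; apply/funext => y; rewrite ReImE.
Qed.

Lemma meanZ (a : R[i]) u : cbmeas u -> mean (fun y => a * u y) = a * mean u.
Proof.
move=> [ur ui]; have bZ (r : R) f : bmeas f -> bmeas (fun y => r * f y).
  by move=> bf; apply: bmeasM => //; exact: bmeas_cst.
apply: complex_ext; rewrite !ReImE /= -!rmeanZ // ?ReImE.
  rewrite -rmeanB; [|exact: bZ|exact: bZ].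
  by congr rmean; apply/funext => y; rewrite !ReImE.
rewrite -rmeanD; [|exact: bZ|exact: bZ].
by congr rmean; apply/funext => y; rewrite !ReImE.
Qed.

Lemma meanZr (a : R[i]) u : cbmeas u -> mean (fun y => u y * a) = mean u * a.
Proof.
by move=> bu; rewrite mulrC -meanZ //; under eq_fun do rewrite mulrC.
Qed.

Lemma meanN u : cbmeas u -> mean (fun y => - u y) = - mean u.
Proof.
move=> bu; rewrite -[RHS]mulN1r -meanZ //; congr mean.
by apply/funext => y; rewrite mulN1r.
Qed.

Lemma meanB u v : cbmeas u -> cbmeas v ->
  mean (fun y => u y - v y) = mean u - mean v.
Proof. by move=> bu bv; rewrite meanD ?meanN //; exact: cbmeasN. Qed.

Lemma mean_sum (I : eqType) (r : seq I) (F : I -> Y -> R[i]) :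
  (forall i, i \in r -> cbmeas (F i)) ->
  mean (fun y => \sum_(i <- r) F i y) = \sum_(i <- r) mean (F i).
Proof.
elim: r => [|i r IHr] bF.
  rewrite big_nil; under eq_fun do rewrite big_nil.
  by have := @meanZ 0 _ (@cbmeas_cst R _ Y 0); rewrite !mul0r.
have bi : cbmeas (F i) by apply: bF; rewrite mem_head.
have br j : j \in r -> cbmeas (F j) by move=> jr; apply: bF; rewrite in_cons jr orbT.
rewrite big_cons -(IHr br) -meanD //; last exact: cbmeas_sum.
by congr mean; apply/funext => y; rewrite big_cons.
Qed.

Lemma meanJ u : cbmeas u -> mean (fun y => (u y)^*%C) = (mean u)^*%C.
Proof.
move=> [ur ui]; apply: complex_ext; rewrite !ReImE /= -?rmeanN //.
  by congr rmean; apply/funext => y; rewrite ReImE.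
by congr rmean; apply/funext => y; rewrite ReImE.
Qed.

Lemma mean_ae u v : cbmeas u -> cbmeas v -> {ae nu, forall y, u y = v y} ->
  mean u = mean v.
Proof.
move=> [ur ui] [vr vi] uv; congr (_ +i* _); apply: rmean_ae => //;
  by apply: filterS uv => y ->.
Qed.

Lemma mean_real f : mean (fun y => (f y)%:C) = (rmean f)%:C.
Proof. by apply: complex_ext => //=; rewrite /rmean Rintegral_cst // mul0r mulr0. Qed.

Definition sqnorm u : R := rmean (fun y => sqmod (u y)).

Lemma sqnorm_ge0 u : 0 <= sqnorm u.
Proof. by apply: rmean_ge0 => y; exact: sqmod_ge0. Qed.

Lemma mean_mulJ u : mean (fun y => u y * (u y)^*%C) = (sqnorm u)%:C.
Proof. by under eq_fun do rewrite mulJ; rewrite mean_real. Qed.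

Lemma sqmod_lincomb (b c : R[i]) z w : sqmod (b * z - c * w^*%C) =
  sqmod b * sqmod z - 2 * Re (b * c^*%C * (z * w)) + sqmod c * sqmod w.
Proof. by rewrite /sqmod !ReImE; ring. Qed.

Lemma cauchy_schwarz u v : cbmeas u -> cbmeas v ->
  sqmod (mean (fun y => u y * v y)) <= sqnorm u * sqnorm v.
Proof.
move=> bu bv; set z := mean _.
have buv : cbmeas (fun y => u y * v y) by exact: cbmeasM.
(* The quadratic polynomial in t is the square norm of t u - z conj(v). *)
have Q (t : R) : 0 <= t ^+ 2 * sqnorm u - 2 * t * sqmod z + sqmod z * sqnorm v.
  have : 0 <= rmean (fun y => sqmod (t%:C * u y - z * (v y)^*%C)).
    by apply: rmean_ge0 => y; exact: sqmod_ge0.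
  under eq_fun do rewrite sqmod_lincomb.
  have b1 : bmeas (fun y => sqmod t%:C * sqmod (u y)).
    by apply: bmeasM; [exact: bmeas_cst|exact: bmeas_sqmod].
  have b3 : bmeas (fun y => sqmod z * sqmod (v y)).
    by apply: bmeasM; [exact: bmeas_cst|exact: bmeas_sqmod].
  have b2' : cbmeas (fun y => t%:C * z^*%C * (u y * v y)).
    by apply: cbmeasM => //; exact: cbmeas_cst.
  have b2 : bmeas (fun y => 2 * Re (t%:C * z^*%C * (u y * v y))).
    by apply: bmeasM; [exact: bmeas_cst|case: b2'].
  rewrite rmeanD ?rmeanB // ?rmeanZ //; try exact: bmeas_sqmod; last first.
  - exact: bmeasB.
  - by case: b2'.
  rewrite -/(sqnorm u) -/(sqnorm v).
  have -> : rmean (fun y => Re (t%:C * z^*%C * (u y * v y))) = t * sqmod z.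
    rewrite -[LHS]/(Re (mean (fun y => t%:C * z^*%C * (u y * v y)))) meanZ //.
    by rewrite -/z -mulrA [_^*%C * z]mulrC mulJ -rmorphM.
  have -> : sqmod t%:C = t ^+ 2 by rewrite /sqmod /= expr0n addr0.
  by rewrite mulrA.
have s0 := sqmod_ge0 z; have a0 := sqnorm_ge0 u; have b0 := sqnorm_ge0 v.
move: (sqmod z) (sqnorm u) (sqnorm v) Q s0 a0 b0 => s a b Q s0 a0 b0.
have [a_eq0|a_neq0] := eqVneq a 0.
  have := Q (b + 1); rewrite a_eq0 mulr0 mul0r add0r => Qb.
  have sb : 0 <= s * b by rewrite mulr_ge0.
  by lra.
have ap : 0 < a by rewrite lt_neqAle eq_sym a_neq0.
have := Q (s / a).
have -> : (s / a) ^+ 2 * a - 2 * (s / a) * s + s * b = s / a * (a * b - s).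
  by field.
have [->|s_neq0] := eqVneq s 0; first by move=> _; rewrite mulr_ge0.
have sp : 0 < s by rewrite lt_neqAle eq_sym s_neq0.
by rewrite pmulr_rge0 ?divr_gt0 // subr_ge0.
Qed.

Section probability_mass.
Hypothesis nu_neq0 : nu [set: Y] != 0%E.

Lemma nuT_gt0 : 0 < fine (nu [set: Y]).
Proof.
rewrite lt_neqAle fine_ge0 // andbT eq_sym.
by apply: contra nu_neq0 => /eqP nu0; rewrite -[nu _]fineK ?fin_num_measure // nu0.
Qed.

Lemma rmean_cst (r : R) : rmean (fun=> r) = r.
Proof.
rewrite /rmean Rintegral_cst // mulrC -mulrA divff ?mulr1 //.
by rewrite gt_eqF // nuT_gt0.
Qed.

Lemma mean_cst (a : R[i]) : mean (fun=> a) = a.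
Proof. by apply: complex_ext; rewrite /= rmean_cst. Qed.

Lemma rmean_indic (A : set Y) : measurable A ->
  rmean \1_A = fine (nu A) / fine (nu [set: Y]).
Proof. by move=> mA; rewrite /rmean /Rintegral integral_indic // setIT mulrC. Qed.

Lemma sqnorm_le u (M : R) : cbmeas u -> (forall y, sqmod (u y) <= M) ->
  sqnorm u <= M.
Proof.
move=> bu uM; rewrite -[leRHS]rmean_cst; apply: rmean_le => //.
  exact: bmeas_sqmod.
exact: bmeas_cst.
Qed.

End probability_mass.

End normalised_integral.

(** * Fubini for bounded functions *)

Section sections_and_fubini.
Context (R : realType) d (Y : measurableType d).
Variable nu : {finite_measure set Y -> \bar R}.
Hypothesis nu_neq0 : nu [set: Y] != 0%E.

Section sections.
Context d' (X : measurableType d').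

Lemma bmeas_section (F : X * Y -> R) x : bmeas F -> bmeas (fun y => F (x, y)).
Proof. by move=> bF; apply: (bmeas_comp _ bF); exact: pair1_measurable. Qed.

Lemma cbmeas_section (F : X * Y -> R[i]) x :
  cbmeas F -> cbmeas (fun y => F (x, y)).
Proof. by move=> bF; apply: (cbmeas_comp _ bF); exact: pair1_measurable. Qed.

Lemma bmeas_rmean (F : X * Y -> R) :
  bmeas F -> bmeas (fun x => rmean nu (fun y => F (x, y))).
Proof.
move=> bF; have [mF [M FM]] := bF; split; last first.
  exists M => x; have bx := bmeas_section x bF.
  have bM : bmeas (fun _ : Y => M) by exact: bmeas_cst.
  have FMx y : - M <= F (x, y) <= M by rewrite -ler_norml.
  rewrite ler_norml; apply/andP; split.
    rewrite -[leLHS](rmean_cst nu_neq0); apply: rmean_le => //.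
      exact: bmeas_cst.
    by move=> y; case/andP: (FMx y).
  rewrite -[leRHS](rmean_cst nu_neq0); apply: rmean_le => // y.
  by case/andP: (FMx y).
(* Tonelli needs a nonnegative integrand, hence the shift by the bound M. *)
have -> : (fun x => rmean nu (fun y => F (x, y))) =
    (fun x => (fine (nu setT))^-1 *
       fine (\int[nu]_y (F (x, y) + M)%:E)%E - M).
  apply/funext => x; have bx := bmeas_section x bF.
  rewrite -[X in _ = X - _]/(rmean nu (fun y => F (x, y) + M)) rmeanD //; last first.
    exact: bmeas_cst.
  by rewrite rmean_cst // addrK.
apply: measurable_funB => //; apply: measurable_funM => //.
apply: (@measurableT_comp _ _ _ _ _ _ fine) => //.
have := @measurable_fun_fubini_tonelli_F _ _ X Y R nu (fun p => (F p + M)%:E).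
apply; first by apply/measurable_EFinP; exact: measurable_funD.
by move=> p; rewrite lee_fin -lerBlDr sub0r; move: (FM p); rewrite ler_norml => /andP[].
Qed.

Lemma cbmeas_mean (F : X * Y -> R[i]) :
  cbmeas F -> cbmeas (fun x => mean nu (fun y => F (x, y))).
Proof.
by move=> [rF iF]; split; [exact: (bmeas_rmean rF)|exact: (bmeas_rmean iF)].
Qed.

End sections.

Lemma rmean_swap (F : Y * Y -> R) : bmeas F ->
  rmean nu (fun x => rmean nu (fun y => F (x, y))) =
  rmean nu (fun y => rmean nu (fun x => F (x, y))).
Proof.
move=> bF; have bFx x := bmeas_section x bF.
have bF' : bmeas (fun p : Y * Y => F (p.2, p.1)).
  by apply: bmeas_comp bF => //; exact: measurable_swap.
have bFy y : bmeas (fun x => F (x, y)) := bmeas_section y bF'.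
have int_fin (f : Y -> R) : bmeas f ->
    (fine (\int[nu]_y (f y)%:E))%:E = (\int[nu]_y (f y)%:E)%E.
  by move=> bf; rewrite fineK // (integrable_fin_num measurableT (bmeas_integrable nu bf)).
rewrite {1 3}/rmean /rmean; congr (_ * _).
have H (G : Y * Y -> R) : bmeas G ->
   \int[nu]_x rmean nu (fun y => G (x, y)) =
   (fine (nu setT))^-1 * fine (\int[nu]_x \int[nu]_y (G (x, y))%:E)%E.
  move=> bG; have -> : (\int[nu]_x \int[nu]_y (G (x, y))%:E)%E =
     (\int[nu]_x (fine (\int[nu]_y (G (x, y))%:E))%:E)%E.
    by apply: eq_integral => x _; rewrite int_fin //; exact: bmeas_section.
  rewrite -RintegralZl //; apply: bmeas_integrable.
  have := bmeas_rmean bG => /(bmeasM (@bmeas_cst R _ Y (fine (nu setT)))).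
  congr bmeas; apply/funext => x.
  by rewrite /rmean mulrA divff ?mul1r // gt_eqF // nuT_gt0.
rewrite (H F bF) (H (fun p => F (p.2, p.1)) bF') /=; congr (_ * fine _).
have mpT : ((nu \x nu)%E [set: Y * Y] < +oo)%E.
  by rewrite -setXTT product_measure1E // lte_mul_pinfty ?fin_num_measure // nuT_lty.
apply: (Fubini (f := EFin \o F)).
have [mF [M FM]] := bF; apply: measurable_bounded_integrable => //.
exists M; split; first exact: num_real.
by move=> N MN x _ /=; rewrite (le_trans (FM x)) // ltW.
Qed.

Lemma mean_swap (F : Y * Y -> R[i]) : cbmeas F ->
  mean nu (fun x => mean nu (fun y => F (x, y))) =
  mean nu (fun y => mean nu (fun x => F (x, y))).
Proof.
by move=> [rF iF]; congr (_ +i* _); [exact: (rmean_swap rF)|exact: (rmean_swap iF)].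
Qed.

End sections_and_fubini.

(** * Log-convex submultiplicative sequences *)

Section power_growth.
Variable R : realType.
Implicit Types A : nat -> R.

(** The ratios of a log-convex sequence increase; let [lam] be their supremum.
    Then [A n / lam ^+ n.+1] decreases, and it stays above 1: from the index
    [k] on, [A] grows at least geometrically with ratio [r k], while
    submultiplicativity bounds its growth over [n.+1] steps by [A n], so that
    [r k ^+ n.+1 <= A n] for all [k]. *)
Lemma logconvex_submul_growth A :
  (forall n, 0 < A n) ->
  (forall n, A n.+1 ^+ 2 <= A n * A n.+2) ->
  (forall m n, A (m + n).+1 <= A m * A n) ->
  exists lam : R, 0 < lam /\
    exists N : R, 1 <= N /\ (fun n => A n / lam ^+ n.+1) @ \oo --> N.
Proof.
move=> A0 Aconv Amul; pose r n := A n.+1 / A n.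
have r0 n : 0 < r n by rewrite divr_gt0.
have r_nd : nondecreasing_seq r.
  apply/nondecreasing_seqP => n.
  by rewrite /r ler_pdivlMr // mulrAC ler_pdivrMr // mulrC -expr2 mulrC.
have r_ub : has_ubound (range r).
  by exists (A 0%N) => _ [n _ <-]; rewrite /r ler_pdivrMr // -[n in n.+1]add0n Amul.
have rlam := nondecreasing_cvgn r_nd r_ub; set lam := sup _ in rlam.
have r_le n : r n <= lam by apply: ub_le_sup => //; exists n.
have lam0 : 0 < lam := lt_le_trans (r0 0%N) (r_le 0%N).
exists lam; split => //.
pose B n := A n / lam ^+ n.+1.
have Alam n : lam ^+ n.+1 <= A n.
  have rA k : r k ^+ n.+1 <= A n.
    have AA m : A k * r k ^+ m <= A (m + k)%N.
      elim: m => [|m IHm]; first by rewrite expr0 mulr1.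
      rewrite exprSr mulrA (le_trans (ler_wpM2r (ltW (r0 k)) IHm)) //.
      have : r k <= r (m + k)%N by apply: r_nd; exact: leq_addl.
      by move/(ler_wpM2l (ltW (A0 (m + k)%N))); rewrite /r [leRHS]mulrC divfK // gt_eqF.
    have := le_trans (AA n.+1) (Amul n k).
    by rewrite [leRHS]mulrC ler_pM2l.
  have rX : (fun k => r k ^+ n.+1) @ \oo --> lam ^+ n.+1.
    exact: (cvg_comp _ _ rlam (@exprn_continuous R n.+1 lam)).
  rewrite -(cvg_lim _ rX) //; apply: limr_le; first exact: cvgP rX.
  exact: nearW.
have B_ge1 n : 1 <= B n by rewrite /B ler_pdivlMr ?exprn_gt0 // mul1r.
have B_ni : nonincreasing_seq B.
  apply/nonincreasing_seqP => n.
  have -> : B n.+1 = B n * (r n / lam).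
    rewrite /B /r [lam ^+ n.+2]exprSr; field.
    by rewrite !gt_eqF // exprn_gt0.
  apply: ler_piMr; first exact: le_trans ler01 (B_ge1 n).
  by rewrite -[leRHS](divff (lt0r_neq0 lam0)) ler_wpM2r ?invr_ge0 ?(ltW lam0).
have B_lb : has_lbound (range B) by exists 1 => _ [k _ <-]; exact: B_ge1.
exists (inf (range B)); split; last exact: nonincreasing_cvgn.
by apply: lb_le_inf; [exists (B 0%N), 0%N|move=> _ [k _ <-]; exact: B_ge1].
Qed.

End power_growth.

(** * Borel measurability on a topological group *)

Section continuous_measurable.
Variables (R : realType) (K : topologicalZmodType).
Local Notation Y := (borel_group K).

Lemma borel_open (U : set K) : open U -> measurable (U : set Y).
Proof. exact: sub_sigma_algebra. Qed.

Lemma open_comp_preimage (T S : topologicalType) (h : T -> S) (U : set S) :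
  continuous h -> open U -> open (h @^-1` U).
Proof. by move=> /continuousP; apply. Qed.

Lemma continuous_borel (h : K -> K) :
  continuous h -> measurable_fun [set: Y] (h : Y -> Y).
Proof.
move=> ch; apply: (@measurability _ _ Y Y _ _ (@open K)) => // _ [U oU <-].
by rewrite setTI; apply: borel_open; exact: open_comp_preimage.
Qed.

Lemma Re_continuous : continuous (@complex.Re R : R[i] -> R).
Proof.
move=> z; apply/(@cvgrPdist_lt _ _ _ (nbhs z) (nbhs_filter z)) => /= e e0.
have e0' : 0 < e%:C by rewrite ltcR.
apply/(@nbhs_ballP _ R[i]^o); exists e%:C => //= w.
rewrite /ball /= => zw; rewrite -ReN -ReD -ltcR.
by rewrite (le_lt_trans (normc_ge_Re _)).
Qed.

Lemma Im_continuous : continuous (@complex.Im R : R[i] -> R).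
Proof.
move=> z; apply/(@cvgrPdist_lt _ _ _ (nbhs z) (nbhs_filter z)) => /= e e0.
have e0' : 0 < e%:C by rewrite ltcR.
apply/(@nbhs_ballP _ R[i]^o); exists e%:C => //= w.
rewrite /ball /= => zw; rewrite -ImN -ImD -ltcR.
by rewrite (le_lt_trans (normc_ge_Im _)).
Qed.

Lemma continuous_measurable_real (g : K -> R) :
  continuous g -> measurable_fun [set: Y] (g : Y -> R).
Proof.
move=> cg; apply: (measurability _ (RGenOInfty.measurableE R)) => _ [_ [x ->] <-]; rewrite setTI; apply: borel_open.
by apply: open_comp_preimage => //; exact: interval_open.
Qed.

Lemma continuous_cbmeas (chi : K -> R[i]) :
  continuous chi -> (forall k, `|chi k| = 1) -> cbmeas (chi : Y -> R[i]).
Proof.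
move=> cchi chi1; apply: cbmeas_norm1 => //; apply: continuous_measurable_real.
  by move=> k; apply: continuous_comp; [exact: cchi|exact: Re_continuous].
by move=> k; apply: continuous_comp; [exact: cchi|exact: Im_continuous].
Qed.

Lemma translation_continuous (a : K) : continuous (fun k : K => a + k).
Proof.
move=> k; apply: (@continuous_comp _ _ _ (fun k => (a, k)) (fun p : K * K => p.1 + p.2)).
  by apply: cvg_pair; [exact: cvg_cst|exact: cvg_id].
exact: add_continuous.
Qed.

Lemma countable_base : @second_countable K ->
  exists b : nat -> set K, (forall n, open (b n)) /\
    forall x (U : set K), nbhs x U -> exists n, b n x /\ b n `<=` U.
Proof.
move=> [B /countable_injP[f finj] [Bo Bb]].
exists (fun n => \bigcup_(V in [set V | B V /\ f V = n]) V); split=> [n|x U xU].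
  by apply: bigcup_open => V [BV _]; exact: Bo.
have [V [BV Vx] VU] := Bb x U xU; exists (f V); split; first by exists V.
move=> y [W [BW fWV] Wy]; apply: VU.
by rewrite -(finj W V) // inE.
Qed.

(** Addition is continuous for the product topology, and a countable base makes
    every open set of the product a countable union of rectangles, hence a
    member of the product of the Borel sigma-algebras. *)
Lemma measurable_add : @second_countable K ->
  measurable_fun [set: Y * Y] (fun p : Y * Y => ((p.1 : K) + p.2) : Y).
Proof.
move=> /countable_base[b [bo bb]].
apply: (@measurability _ _ _ Y _ _ (@open K)) => // _ [U oU <-].
rewrite setTI; set W := _ @^-1` U.
have -> : W = \bigcup_n \bigcup_m
    (if pselect (b n `*` b m `<=` W) then b n `*` b m else set0).
  apply/seteqP; split => [[x y] Wxy|[x y] [n _ [m _]]]; last first.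
    by case: pselect => // nmW /nmW.
  have : nbhs ((x, y) : K * K) ((fun p : K * K => p.1 + p.2) @^-1` U).
    by apply: add_continuous; apply: open_nbhs_nbhs.
  move=> [[A B] /= [xA yB] ABU].
  have [n [nx nA]] := bb x A xA; have [m [my mB]] := bb y B yB.
  exists n => //; exists m => //; case: pselect => [_|[]] //.
  by move=> [x' y'] [/= /nA Ax /mB By]; exact: (ABU (x', y')).
apply: bigcup_measurable => n _; apply: bigcup_measurable => m _.
by case: pselect => H; [apply: measurableX; exact: borel_open|exact: measurable0].
Qed.

End continuous_measurable.

Section measure_preserving.
Context (R : realType) d (Y : measurableType d).
Variable nu : {finite_measure set Y -> \bar R}.

Lemma rmean_measure_preserving (h : Y -> Y) (f : Y -> R) :
  measurable_fun [set: Y] h ->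
  (forall A, measurable A -> nu (h @^-1` A) = nu A) -> bmeas f ->
  rmean nu (fun y => f (h y)) = rmean nu f.
Proof.
move=> mh nuh bf; rewrite /rmean /Rintegral; congr (_ * fine _).
have mf : measurable_fun [set: Y] (EFin \o f).
  by apply/measurable_EFinP; case: bf.
have ifh : nu.-integrable (h @^-1` setT) ((EFin \o f) \o h).
  exact: (bmeas_integrable nu (bmeas_comp mh bf)).
have := integral_pushforward mh mf ifh measurableT.
rewrite preimage_setT => <-; apply: eq_measure_integral => A mA _.
exact: nuh.
Qed.

Lemma mean_measure_preserving (h : Y -> Y) (u : Y -> R[i]) :
  measurable_fun [set: Y] h ->
  (forall A, measurable A -> nu (h @^-1` A) = nu A) -> cbmeas u ->
  mean nu (fun y => u (h y)) = mean nu u.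
Proof.
move=> mh nuh [ur ui].
by congr (_ +i* _); [exact: (rmean_measure_preserving mh nuh ur)
                    |exact: (rmean_measure_preserving mh nuh ui)].
Qed.

End measure_preserving.

(** * Haar measure: invariance, support, continuity of translations *)

Section haar.
Variables (R : realType) (K : topologicalZmodType).
Variable nu : {finite_measure set (borel_group K) -> \bar R}.
Hypothesis K_sc : @second_countable K.
Hypothesis nu_haar : haar_measure nu.
Local Notation Y := (borel_group K).
Implicit Types (u v : K -> R[i]) (B : set Y).

Let nu_neq0 : nu [set: Y] != 0%E := nu_haar.1.

Lemma borel_translation (a : K) :
  measurable_fun [set: Y] ((fun k : K => a + k) : Y -> Y).
Proof. by apply: continuous_borel; exact: translation_continuous. Qed.

Lemma borel_opp : measurable_fun [set: Y] ((fun k : K => - k) : Y -> Y).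
Proof. by apply: continuous_borel; exact: opp_continuous. Qed.

Lemma rmean_translate (a : K) (f : Y -> R) : bmeas f ->
  rmean nu (fun k => f ((a : K) + k)) = rmean nu f.
Proof.
apply: rmean_measure_preserving; first exact: borel_translation.
by move=> A mA; exact: nu_haar.2.
Qed.

Lemma mean_translate (a : K) u : cbmeas (u : Y -> R[i]) ->
  mean nu (fun k => u (a + k)) = mean nu u.
Proof.
apply: mean_measure_preserving; first exact: borel_translation.
by move=> A mA; exact: nu_haar.2.
Qed.

(** This is uniqueness of the Haar measure: averaging [u (t k + l)] over [l]
    first gives the mean of [u], over [k] first gives the mean of [u \o t]. *)
Lemma mean_automorphism (t s : K -> K) u :
  continuous t -> {morph t : k l / k + l} -> cancel s t ->
  cbmeas (u : Y -> R[i]) -> mean nu (fun k => u (t k)) = mean nu u.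
Proof.
move=> ct tD st bu; have mt := continuous_borel ct.
have but : cbmeas (fun k : Y => u (t k)) by exact: cbmeas_comp mt bu.
have bF : cbmeas (fun p : Y * Y => u (t p.1 + p.2)).
  apply: (cbmeas_comp (h := fun p : Y * Y => (t p.1 + p.2 : K) : Y)) => //.
  have mp : measurable_fun setT (fun p : Y * Y => ((t p.1 : Y), p.2)).
    apply: measurable_fun_pair => //.
    exact: (measurableT_comp mt measurable_fst).
  exact: (measurableT_comp (measurable_add K_sc) mp).
have := mean_swap nu_neq0 bF => /=.
under eq_fun do rewrite mean_translate //.
rewrite mean_cst // => ->.
have E l : mean nu (fun k => u (t k + l)) = mean nu (fun k => u (t k)).
  have := mean_translate (s l) but.
  by under eq_fun do rewrite tD st addrC.
by under [X in _ = mean nu X]eq_fun do rewrite E; rewrite mean_cst.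
Qed.

Lemma mean_opp u : cbmeas (u : Y -> R[i]) ->
  mean nu (fun k => u (- k)) = mean nu u.
Proof.
apply: (@mean_automorphism (fun k => - k) (fun k => - k)).
- exact: opp_continuous.
- by move=> k l; rewrite opprD.
- exact: opprK.
Qed.

(** If [U] were null, every point would have a null basic neighbourhood, inside
    a translate of [U], and countably many of these cover the group. *)
Lemma open_measure_neq0 (U : set K) x : open U -> U x -> nu (U : set Y) != 0%E.
Proof.
move=> oU Ux; apply/negP => /eqP nuU0.
have [b [bo bb]] := countable_base K_sc.
pose c n : set Y := if pselect (nu (b n : set Y) = 0%E) then b n else set0.
have c0 n : nu.-negligible (c n).
  rewrite /c; case: pselect => [b0|nb0]; last exact: negligible_set0.
  by exists (b n); split => //; exact: borel_open.
have : nu [set: Y] = 0%E.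
  apply: measure_negligible => //.
  apply: negligibleS (negligible_bigcup c0) => y _.
  have oUy : open [set l : K | U ((x - y) + l)].
    by apply: open_comp_preimage => //; exact: translation_continuous.
  have nUy : nbhs y [set l : K | U ((x - y) + l)].
    by apply: open_nbhs_nbhs; split => //=; rewrite subrK.
  have [n [bny bnU]] := bb y _ nUy.
  exists n => //; rewrite /c; case: pselect => // -[].
  apply/eqP; rewrite -measure_le0 -nuU0.
  have mU : measurable (U : set Y) by exact: borel_open.
  rewrite -(nu_haar.2 (x - y) U) //; apply: le_measure; rewrite ?inE //.
    exact: borel_open.
  exact: borel_open.
by move/eqP; rewrite (negbTE nu_neq0).
Qed.

(** The measure of the symmetric difference of [B] and its translate by [- k],
    relative to the total mass. *)
Definition shift_defect B (k : K) : R :=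
  rmean nu (fun l => `|\1_B ((k : K) + l) - \1_B l|).

Definition shift_continuous B : Prop := measurable B /\
  forall e : R, 0 < e -> nbhs (0 : K) [set k | shift_defect B k <= e].

Lemma bmeas_shift B k : measurable B ->
  bmeas (fun l : Y => \1_B ((k : K) + l) : R).
Proof.
move=> mB; apply: (bmeas_comp (borel_translation k)); exact: bmeas_indic.
Qed.

Lemma bmeas_abs (f : Y -> R) : bmeas f -> bmeas (fun x => `|f x|).
Proof.
move=> [mf [M fM]]; split; first exact: (measurableT_comp _ mf).
by exists M => x; rewrite normr_id.
Qed.

Lemma bmeas_miss B C k : measurable B -> measurable C ->
  bmeas (fun l : Y => \1_C l * (1 - \1_B ((k : K) + l)) : R).
Proof.
move=> mB mC; apply: bmeasM; first exact: bmeas_indic.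
by apply: bmeasB; [exact: bmeas_cst|exact: bmeas_shift].
Qed.

(** A translate of [B] has the measure of [B], so it is enough to control the
    points of [B] that the translation moves out of [B]. All of [B] but a small
    part lies in finitely many of the [C n]. *)
Lemma shift_continuous_bigcup B (C : nat -> set Y) :
  (forall n, measurable (C n)) -> B = \bigcup_n C n ->
  (forall n (e : R), 0 < e ->
    nbhs (0 : K) [set k | rmean nu (fun l => \1_(C n) l * (1 - \1_B ((k : K) + l))) <= e]) ->
  shift_continuous B.
Proof.
move=> mC BC missC.
have mB : measurable B by rewrite BC; exact: bigcup_measurable.
pose G N : set Y := \big[setU/set0]_(i < N.+1) C i.
have mG N : measurable (G N) by apply: bigsetU_measurable.
have bmiss D k : measurable D -> bmeas (fun l : Y => \1_D l * (1 - \1_B ((k : K) + l)) : R).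
  exact: bmeas_miss.
have ge0miss D k l : 0 <= \1_D l * (1 - \1_B ((k : K) + l)) :> R.
  by rewrite mulr_ge0 // ?subr_ge0 indicE // lern1 leq_b1.
have missG N (e : R) : 0 < e ->
    nbhs (0 : K) [set k | rmean nu (fun l => \1_(G N) l * (1 - \1_B ((k : K) + l))) <= e].
  rewrite /G; elim: {N} N.+1 e => [|N IHN] e e0.
    apply: nearW => k /=; rewrite big_ord0 [X in rmean nu X](_ : _ = fun=> 0) ?rmean_cst ?ltW //.
    by apply/funext => l; rewrite indic0 mul0r.
  have e20 : 0 < e / 2 by rewrite divr_gt0.
  apply: filterS2 (IHN _ e20) (missC N _ e20) => k /= IHk Ck.
  rewrite [e]splitr; apply: le_trans (lerD IHk Ck).
  have mGN : measurable (\big[setU/set0]_(i < N) C i).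
    by apply: bigsetU_measurable.
  rewrite -rmeanD; [|exact: bmiss|exact: bmiss].
  rewrite big_ord_recr /=; apply: rmean_le; first exact/bmiss/measurableU.
    by apply: bmeasD; exact: bmiss.
  move=> l; rewrite -mulrDl; apply: ler_wpM2r.
    by rewrite subr_ge0 indicE lern1 leq_b1.
  rewrite !indicE in_setU; case: (l \in _) => /=; first by rewrite lerDl.
  by rewrite add0r.
split => // e e0.
have e40 : 0 < e / 4 by rewrite divr_gt0.
have [N GN] : exists N, rmean nu \1_B - rmean nu \1_(G N) <= e / 4.
  have GB : \bigcup_N G N = B by rewrite BC; exact: bigcup_bigsetU_bigcup.
  have /fine_cvgP[_ cG] : (nu \o G) x @[x --> \oo] --> (fine (nu B))%:E.
    rewrite fineK ?fin_num_measure // -GB; apply: nondecreasing_cvg_mu => //.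
      by rewrite GB.
    by move=> m n mn; apply/subsetPset/subset_bigsetU.
  have [] := (@cvgrPdist_le _ _ _ _ _ _ _).1 cG (e / 4 * fine (nu setT)).
    by rewrite mulr_gt0 // nuT_gt0.
  move=> N _ /(_ N (leqnn N)) /= H; exists N.
  rewrite !rmean_indic // -mulrBl ler_pdivrMr ?nuT_gt0 //.
  exact: le_trans (ler_norm _) H.
apply: filterS (missG N _ e40) => k /= missk.
(* With a and b the values of the indicator of B at k + l and l, the bound is
   |a - b| <= (a - b) + 2 (b - a)^+, and a - b has mean zero. *)
have -> : e = 0 + 2 * (e / 4) + 2 * (e / 4) by field.
have bB : bmeas (\1_B : Y -> R) by exact: bmeas_indic.
have bG : bmeas (\1_(G N) : Y -> R) by exact: bmeas_indic.
have bBk := bmeas_shift k mB.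
have -> : 0 = rmean nu (fun l => \1_B ((k : K) + l) - \1_B l) :> R.
  by rewrite rmeanB // (rmean_translate k bB) subrr.
have b1 : bmeas (fun l : Y => \1_B ((k : K) + l) - \1_B l : R) by exact: bmeasB.
have b2 : bmeas (fun l : Y => 2 * (\1_B l - \1_(G N) l) : R).
  by apply: bmeasM; [exact: bmeas_cst|exact: bmeasB].
have b3 : bmeas (fun l : Y => 2 * (\1_(G N) l * (1 - \1_B ((k : K) + l))) : R).
  by apply: bmeasM; [exact: bmeas_cst|exact: bmiss].
apply: le_trans (lerD (lerD (lexx _) (ler_wpM2l _ GN)) (ler_wpM2l _ missk)) => //.
rewrite -rmeanB // -!rmeanZ //; [|exact: bmiss|exact: bmeasB].
rewrite -!rmeanD //; last exact: bmeasD.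
apply: rmean_le; [exact: bmeas_abs|by do 2!apply: bmeasD => //|].
move=> l; have GlB : l \in G N -> l \in B.
  by rewrite !inE BC; exact: bigsetU_bigcup.
rewrite !indicE; case: (boolP (l \in G N)) => [/GlB ->|_].
  by case: (_ \in B) => /=; rewrite ?subrr ?normr0 ?sub0r ?normrN ?normr1; lra.
case: (l \in B); case: (_ \in B) => /=;
  rewrite ?subrr ?normr0 ?sub0r ?subr0 ?normrN ?normr1; lra.
Qed.

(** The basic open sets [b m] such that [b j + b m] is inside [U] for some basic
    neighbourhood [b j] of 0 cover [U], and a shift by an element of [b j] moves
    no point of [b m] out of [U]. *)
Lemma shift_continuous_open (U : set K) : open U -> shift_continuous U.
Proof.
move=> oU; have [b [bo bb]] := countable_base K_sc.
pose good m j := b j 0 /\ forall x y : K, b m x -> b j y -> U (y + x).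
pose C m : set Y := if pselect (exists j, good m j) then b m else set0.
have mC n : measurable (C n).
  by rewrite /C; case: pselect => H; [exact: borel_open|exact: measurable0].
apply: (shift_continuous_bigcup mC).
  apply/seteqP; split => [x Ux|x [m _]]; last first.
    rewrite /C; case: pselect => // -[j [j0 jU]] mx.
    by have := jU x 0 mx j0; rewrite add0r.
  have : nbhs ((0, x) : K * K) ((fun p : K * K => p.1 + p.2) @^-1` U).
    by apply: add_continuous; apply: open_nbhs_nbhs; rewrite /= add0r.
  move=> [[V A] /= [V0 xA] VAU].
  have [m [mx mA]] := bb x A xA; have [j [j0 jV]] := bb 0 V V0.
  exists m => //; rewrite /C; case: pselect => // -[]; exists j; split => //.
  by move=> y v /mA Ay /jV Vv; exact: (VAU (v, y)).
move=> n e e0; rewrite /C; case: pselect => [[j [j0 jU]]|H]; last first.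
  apply: nearW => k /=; rewrite [X in rmean nu X](_ : _ = fun=> 0) ?rmean_cst ?ltW //.
  by apply/funext => l; rewrite indic0 mul0r.
have : nbhs (0 : K) (b j) by apply: open_nbhs_nbhs.
apply: filterS => k jk /=.
rewrite [X in rmean nu X](_ : _ = fun=> 0) ?rmean_cst ?ltW //.
apply/funext => l; rewrite !indicE; case: (boolP (l \in b n)); last by rewrite mul0r.
by rewrite inE => nl; rewrite mem_set ?subrr ?mulr0 //; exact: jU.
Qed.

(** The sets whose translates depend continuously on the shift, in measure, form
    a sigma-algebra that contains the open sets. *)
Lemma shift_continuous_measurable B : measurable B -> shift_continuous B.
Proof.
apply: (@smallest_sub _ (sigma_algebra setT) (@open K) shift_continuous); last first.
  exact: shift_continuous_open.
split.
- exact: (shift_continuous_open (@open0 K)).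
- move=> A [mA cA]; rewrite setTD; split; first exact: measurableC.
  move=> e e0; apply: filterS (cA e e0) => k /=; congr (_ <= _); congr rmean.
  apply/funext => l; rewrite !indicE !in_setC.
  by case: (_ \in A); case: (_ \in A);
    rewrite /= ?subrr ?sub0r ?subr0 ?normrN ?normr1.
- move=> A cA; have mA n : measurable (A n : set Y) by case: (cA n).
  apply: (shift_continuous_bigcup mA) => // n e e0.
  apply: filterS ((cA n).2 e e0) => k /=; apply: le_trans; apply: rmean_le.
  + by apply: bmeas_miss => //; exact: bigcup_measurable.
  + apply: bmeas_abs => //; apply: bmeasB; [exact: bmeas_shift|exact: bmeas_indic].
  + move=> l; rewrite !indicE; set A' := \bigcup_k _.
    have AB : ((k : K) + l : Y) \in A n -> ((k : K) + l : Y) \in A'.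
      by rewrite !inE => Akl; exists n.
    case: (boolP (_ \in A n)) AB => [_ -> //|_ _]; first by rewrite subrr mulr0.
    by case: (l \in A n); case: (_ \in A');
      rewrite /= ?subrr ?mulr0 ?mul0r ?subr0 ?sub0r ?mulr1 ?normrN ?normr1.
Qed.

End haar.

(** * Uniform limits *)

Section uniform_limits.
Variables (R : realType) (T : Type).
Implicit Types (f : nat -> T -> R[i]) (g : T -> R[i]).

Definition ucvg f g : Prop := forall e : R, 0 < e ->
  exists n0, forall i, (n0 <= i)%N -> forall t, sqmod (f i t - g t) <= e.

Lemma sqmodD_le (z w : R[i]) : sqmod (z + w) <= 2 * sqmod z + 2 * sqmod w.
Proof.
rewrite /sqmod !ReImE; move: (Re z) (Im z) (Re w) (Im w) => a b c e.
have := sqr_ge0 (a - c); have := sqr_ge0 (b - e); nra.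
Qed.

Lemma ucvg_unique f g h : ucvg f g -> ucvg f h -> g = h.
Proof.
move=> fg fh; apply/funext => t; apply/eqP; rewrite -subr_eq0 -sqmod_eq0.
rewrite eq_le sqmod_ge0 andbT; apply/ler_addgt0Pl => e e0; rewrite addr0.
have e4 : 0 < e / 4 by rewrite divr_gt0.
have [n0 gn] := fg _ e4; have [n1 hn] := fh _ e4.
have := gn (maxn n0 n1) (leq_maxl _ _) t; have := hn (maxn n0 n1) (leq_maxr _ _) t.
move: (f _ _) => z hz gz; have -> : g t - h t = (g t - z) + (z - h t) by ring.
by have := sqmodD_le (g t - z) (z - h t); rewrite [sqmod (g t - z)]sqmodB; lra.
Qed.

Lemma ucvg_shift f g (s : nat -> nat) :
  (forall i, (i <= s i)%N) -> ucvg f g -> ucvg (fun i => f (s i)) g.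
Proof.
move=> si fg e e0; have [n0 H] := fg e e0; exists n0 => i n0i.
exact/H/(leq_trans n0i (si i)).
Qed.

Lemma ucvg_cst g : ucvg (fun=> g) g.
Proof. by move=> e e0; exists 0%N => i _ t; rewrite subrr sqmod0 ltW. Qed.

Lemma ucauchy_ucvg f :
  (forall e : R, 0 < e -> exists n0, forall i j, (n0 <= i)%N -> (n0 <= j)%N ->
     forall t, sqmod (f i t - f j t) <= e) ->
  exists g, ucvg f g.
Proof.
move=> fC.
have lim_real (p : R[i] -> R) :
    (forall z w, `|p z - p w| ^+ 2 <= sqmod (z - w)) ->
    exists h : T -> R, forall e : R, 0 < e -> exists n0, forall i, (n0 <= i)%N ->
      forall t, `|p (f i t) - h t| <= e.
  move=> pl.
  have pC (e : R) : 0 < e -> exists n0, forall i j, (n0 <= i)%N -> (n0 <= j)%N ->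
      forall t, `|p (f i t) - p (f j t)| <= e.
    move=> e0; have [n0 H] := fC (e ^+ 2) (exprn_gt0 2 e0).
    exists n0 => i j n0i n0j t.
    rewrite -(@ler_pXn2r _ 2) // ?nnegrE ?(ltW e0) //.
    exact: le_trans (pl _ _) (H i j n0i n0j t).
  have cv t : cvgn (fun i => p (f i t)).
    apply/cauchy_cvgP/cauchyP => e e0; have [n0 H] := pC _ (divr_gt0 e0 (ltr0n _ 2)).
    exists (p (f n0 t)); exists n0 => //= i n0i.
    rewrite /ball /= (le_lt_trans (H _ _ (leqnn _) n0i t)) // ltr_pdivrMr //.
    by rewrite ltr_pMr // ltr1n.
  exists (fun t => limn (fun i => p (f i t))) => e e0.
  have [n0 H] := pC e e0; exists n0 => i n0i t.
  have cvi : (fun j => `|p (f i t) - p (f j t)|) @ \oo -->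
      `|p (f i t) - limn (fun i => p (f i t))|.
    by apply: cvg_norm; apply: cvgB; [exact: cvg_cst|exact: cv].
  rewrite -(cvg_lim _ cvi) //; apply: limr_le; first exact: cvgP cvi.
  by exists n0 => //= j n0j; exact: H.
have [|hr Hr] := lim_real (@complex.Re R).
  by move=> z w; rewrite -ReN -ReD; exact: Re_le_sqmod.
have [|hi Hi] := lim_real (@complex.Im R).
  by move=> z w; rewrite -ImN -ImD; exact: Im_le_sqmod.
exists (fun t => hr t +i* hi t) => e e0.
pose d := Num.min 1 (e / 2); have d0 : 0 < d by rewrite lt_min ltr01 divr_gt0.
have d2 : d ^+ 2 <= e / 2.
  have d1 : d <= 1 by rewrite ge_min lexx.
  have de : d <= e / 2 by rewrite ge_min lexx orbT.
  by rewrite expr2; nra.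
have [n0 H0] := Hr d d0; have [n1 H1] := Hi d d0.
exists (maxn n0 n1) => i; rewrite geq_max => /andP[n0i n1i] t.
rewrite /sqmod !ReImE /= [e]splitr lerD //; apply: le_trans d2.
  by rewrite -real_normK ?num_real // ler_pXn2r ?nnegrE ?H0 // ltW.
by rewrite -real_normK ?num_real // ler_pXn2r ?nnegrE ?H1 // ltW.
Qed.

Lemma ucvg_Re f g t : ucvg f g -> (fun i => Re (f i t)) @ \oo --> Re (g t).
Proof.
move=> fg; apply/cvgrPdist_le => /= e e0.
have [n0 H] := fg _ (exprn_gt0 2 e0); exists n0 => //= i n0i.
rewrite -(@ler_pXn2r _ 2) // ?nnegrE ?(ltW e0) // distrC -ReN -ReD.
exact: le_trans (Re_le_sqmod _) (H i n0i t).
Qed.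

Lemma ucvg_Im f g t : ucvg f g -> (fun i => Im (f i t)) @ \oo --> Im (g t).
Proof.
move=> fg; apply/cvgrPdist_le => /= e e0.
have [n0 H] := fg _ (exprn_gt0 2 e0); exists n0 => //= i n0i.
rewrite -(@ler_pXn2r _ 2) // ?nnegrE ?(ltW e0) // distrC -ImN -ImD.
exact: le_trans (Im_le_sqmod _) (H i n0i t).
Qed.

End uniform_limits.

Lemma ucvg_cbmeas (R : realType) d (T : measurableType d)
    (f : nat -> T -> R[i]) (g : T -> R[i]) :
  (forall n, cbmeas (f n)) -> ucvg f g -> cbmeas g.
Proof.
move=> bf fg; have [n0 H] := fg 1 ltr01.
have [M fM] := cbmeas_bound (bf n0).
have gM t : sqmod (g t) <= (2 + 2 * M + 1) ^+ 2.
  have := sqmodD_le (g t - f n0 t) (f n0 t); rewrite subrK sqmodB.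
  have := H n0 (leqnn _) t; have := fM t; have := sqmod_ge0 (f n0 t).
  by rewrite expr2; nra.
have M0 : 0 <= 2 + 2 * M + 1.
  have := fM point; have := sqmod_ge0 (f n0 point); lra.
split; split.
- apply: (@measurable_fun_cvg _ _ _ _ (fun n t => Re (f n t))) => //.
    by move=> n; case: (bf n) => -[].
  by move=> t _; exact: ucvg_Re.
- exists (2 + 2 * M + 1) => t; rewrite -(@ler_pXn2r _ 2) // ?nnegrE //.
  exact: le_trans (Re_le_sqmod _) (gM t).
- apply: (@measurable_fun_cvg _ _ _ _ (fun n t => Im (f n t))) => //.
    by move=> n; case: (bf n) => _ [].
  by move=> t _; exact: ucvg_Im.
- exists (2 + 2 * M + 1) => t; rewrite -(@ler_pXn2r _ 2) // ?nnegrE //.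
  exact: le_trans (Im_le_sqmod _) (gM t).
Qed.

(** * Convolution and powers of a Hermitian function *)

Section convolution.
Variables (R : realType) (K : topologicalZmodType).
Variable nu : {finite_measure set (borel_group K) -> \bar R}.
Hypothesis K_sc : @second_countable K.
Hypothesis nu_haar : haar_measure nu.
Local Notation Y := (borel_group K).
Implicit Types (u v w E F : K -> R[i]).

Let nu_neq0 : nu [set: Y] != 0%E := nu_haar.1.

Local Notation bm u := (cbmeas (u : borel_group K -> _)).
Local Notation sqnorm := (sqnorm nu).

(** Convolution is taken at every point, not up to null sets: the identities
    below hold everywhere, and Cauchy-Schwarz turns square norm estimates of the
    factors into uniform estimates of the product. *)
Definition convol u v : K -> R[i] := fun k => mean nu (fun l => u (k - l) * v l).

Definition tilde u : K -> R[i] := fun k => (u (- k))^*%C.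

Lemma bm_translate a u : bm u -> bm (fun k : K => u (a + k)).
Proof. exact: (cbmeas_comp (borel_translation a)). Qed.

Lemma bm_opp u : bm u -> bm (fun k : K => u (- k)).
Proof. exact: (cbmeas_comp (@borel_opp K)). Qed.

Lemma bm_reflect k u : bm u -> bm (fun l : K => u (k - l)).
Proof. by move=> bu; exact: (bm_opp (bm_translate k bu)). Qed.

Lemma bm_tilde u : bm u -> bm (tilde u).
Proof. by move=> bu; apply: cbmeasJ; exact: bm_opp. Qed.

Lemma bmM u v : bm u -> bm v -> bm (fun k : K => u k * v k).
Proof. exact: cbmeasM. Qed.

Lemma bmD u v : bm u -> bm v -> bm (fun k : K => u k + v k).
Proof. exact: cbmeasD. Qed.

Lemma bmB u v : bm u -> bm v -> bm (fun k : K => u k - v k).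
Proof. exact: cbmeasB. Qed.

Lemma bmZ a u : bm u -> bm (fun k : K => a * u k).
Proof. by apply: cbmeasM; exact: cbmeas_cst. Qed.

Local Hint Resolve bm_translate bm_opp bm_reflect bm_tilde bmM bmD bmB bmZ : core.

Lemma mean_reflect k u : bm u -> mean nu (fun l => u (k - l)) = mean nu u.
Proof.
move=> bu; rewrite -(mean_translate nu_haar k bu).
exact: (mean_opp K_sc nu_haar (bm_translate k bu)).
Qed.

Lemma bm_kernel u : bm u ->
  cbmeas (fun p : Y * Y => u (p.1 - p.2)).
Proof.
move=> bu; apply: (cbmeas_comp (h := fun p : Y * Y => (p.1 - p.2 : K) : Y)) => //.
have mp : measurable_fun setT (fun p : Y * Y => (p.1, (- p.2 : K) : Y)).
  apply: measurable_fun_pair => //.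
  exact: (measurableT_comp (@borel_opp K) measurable_snd).
exact: (measurableT_comp (measurable_add K_sc) mp).
Qed.

Lemma bm_convol u v : bm u -> bm v -> bm (convol u v).
Proof.
move=> bu bv.
apply: (cbmeas_mean nu_neq0 (F := fun p : Y * Y => u (p.1 - p.2) * v p.2)).
apply: cbmeasM; first exact: bm_kernel.
exact: (cbmeas_comp measurable_snd bv).
Qed.
Local Hint Resolve bm_convol : core.

Lemma convolC u v : bm u -> bm v -> convol u v = convol v u.
Proof.
move=> bu bv; apply/funext => k; rewrite /convol.
rewrite -(mean_reflect k (u := fun l => u (k - l) * v l)); last by auto.
by congr mean; apply/funext => l; rewrite opprB addrC subrK mulrC.
Qed.

Lemma convolA u v w : bm u -> bm v -> bm w ->
  convol (convol u v) w = convol u (convol v w).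
Proof.
move=> bu bv bw; apply/funext => k; rewrite /convol.
have E p l : bm (fun l => u (k - p) * (v (p - l) * w l)) by auto.
transitivity (mean nu (fun l => mean nu (fun p => u (k - p) * (v (p - l) * w l)))).
  congr mean; apply/funext => l; rewrite -meanZr; last by auto.
  have bg : bm (fun p : K => u (k - p) * (v (p - l) * w l)).
    apply: bmM; first by auto.
    apply: bmM; last exact: cbmeas_cst.
    by under eq_fun do rewrite addrC; auto.
  rewrite -(mean_translate nu_haar l bg); congr mean; apply/funext => p.
  by rewrite opprD addrA [l + p]addrC addrK mulrA.
rewrite -(mean_swap nu_neq0 (F := fun p : Y * Y =>
  u (k - p.1) * (v (p.1 - p.2) * w p.2))).
  by congr mean; apply/funext => p /=; rewrite meanZ; auto.
apply: cbmeasM.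
  by apply: (cbmeas_comp measurable_fst (bm_reflect k bu)).
apply: cbmeasM; first exact: bm_kernel.
exact: (cbmeas_comp measurable_snd bw).
Qed.

Lemma convolDl u v w : bm u -> bm v -> bm w ->
  convol (fun k => u k + v k) w = (fun k => convol u w k + convol v w k).
Proof.
move=> bu bv bw; apply/funext => k; rewrite /convol -meanD; [|by auto|by auto].
by congr mean; apply/funext => l; rewrite mulrDl.
Qed.

Lemma convolZl a u w : bm u -> bm w ->
  convol (fun k => a * u k) w = (fun k => a * convol u w k).
Proof.
move=> bu bw; apply/funext => k; rewrite /convol -meanZ; last by auto.
by congr mean; apply/funext => l; rewrite mulrA.
Qed.

Lemma convolBl u v w : bm u -> bm v -> bm w ->
  convol (fun k => u k - v k) w = (fun k => convol u w k - convol v w k).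
Proof.
move=> bu bv bw; apply/funext => k; rewrite /convol -meanB; [|by auto|by auto].
by congr mean; apply/funext => l; rewrite mulrBl.
Qed.

Lemma convolDr u v w : bm u -> bm v -> bm w ->
  convol w (fun k => u k + v k) = (fun k => convol w u k + convol w v k).
Proof.
move=> bu bv bw; rewrite convolC; [|by auto|by auto].
by rewrite convolDl // (convolC bu) // (convolC bv).
Qed.

Lemma convolZr a u w : bm u -> bm w ->
  convol w (fun k => a * u k) = (fun k => a * convol w u k).
Proof.
by move=> bu bw; rewrite convolC; [rewrite convolZl // (convolC bu)|by auto|by auto].
Qed.

Lemma convolBr u v w : bm u -> bm v -> bm w ->
  convol w (fun k => u k - v k) = (fun k => convol w u k - convol w v k).
Proof.
move=> bu bv bw; rewrite convolC; [|by auto|by auto].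
by rewrite convolBl // (convolC bu) // (convolC bv).
Qed.

Lemma convol_translate a u v :
  convol (fun k => u (a + k)) v = (fun k => convol u v (a + k)).
Proof.
by apply/funext => k; congr mean; apply/funext => l; rewrite addrA.
Qed.

Lemma tilde_convol u v : bm u -> bm v -> tilde (convol u v) = convol (tilde u) (tilde v).
Proof.
move=> bu bv; apply/funext => k; rewrite /tilde /convol -meanJ; last by auto.
rewrite -mean_opp //; last by apply: cbmeasJ; auto.
by congr mean; apply/funext => l; rewrite rmorphM /= opprB opprK addrC.
Qed.

Lemma tildeK u : tilde (tilde u) = u.
Proof. by apply/funext => k; rewrite /tilde opprK conjcK. Qed.

Lemma sqnorm_reflect k u : bm u -> sqnorm (fun l => u (k - l)) = sqnorm u.
Proof.
move=> bu; have bs : bm (fun l => (sqmod (u l))%:C).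
  by apply: cbmeas_real; exact: bmeas_sqmod.
by have := mean_reflect k bs; rewrite !mean_real => -[].
Qed.

Lemma convol_tilde0 u : bm u -> convol u (tilde u) 0 = (sqnorm u)%:C.
Proof.
move=> bu; rewrite -mean_mulJ -(mean_reflect 0); last by apply: bmM => //; apply: cbmeasJ.
by congr mean; apply/funext => l; rewrite /tilde sub0r.
Qed.

Lemma convol_bound u v k : bm u -> bm v -> sqmod (convol u v k) <= sqnorm u * sqnorm v.
Proof.
move=> bu bv; rewrite -(sqnorm_reflect k bu).
by apply: cauchy_schwarz; auto.
Qed.

Lemma ucvg_convol w (f : nat -> K -> R[i]) E : bm w -> (forall n, bm (f n)) -> bm E ->
  ucvg f E -> ucvg (fun n => convol w (f n)) (convol w E).
Proof.
move=> bw bf bE fE e e0; have s0 := sqnorm_ge0 nu w.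
have [|n0 H] := fE (e / (sqnorm w + 1)).
  by rewrite divr_gt0 // ltr_wpDl.
exists n0 => i n0i k.
have -> : convol w (f i) k - convol w E k = convol w (fun l => f i l - E l) k.
  by rewrite convolBr.
apply: (le_trans (convol_bound k bw _)); first by auto.
have : sqnorm (fun l => f i l - E l) <= e / (sqnorm w + 1).
  by apply: sqnorm_le => //; [auto|exact: H].
move/(ler_wpM2l s0) => /le_trans; apply.
rewrite mulrCA ler_piMr ?(ltW e0) // ler_pdivrMr ?mul1r ?lerDl //.
by rewrite ltr_wpDl.
Qed.

Lemma ucvg_tilde (f : nat -> K -> R[i]) E :
  ucvg f E -> ucvg (fun n => tilde (f n)) (tilde E).
Proof.
move=> fE e e0; have [n0 H] := fE e e0; exists n0 => i n0i k.
by rewrite /tilde -rmorphB sqmodJ; exact: H.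
Qed.

(** Convolution by a Hermitian idempotent is the orthogonal projection onto a
    translation-invariant subspace of L^2 of finite dimension, and the square
    norm of the idempotent is this dimension. *)
Definition projection E : Prop := [/\ bm E, tilde E = E & convol E E = E].

Local Opaque convol.

Section powers.
Variable w : K -> R[i].
Hypotheses (bw : bm w) (w_herm : tilde w = w).
Variable W : nat -> K -> R[i].
Hypotheses (W0 : W 0 = w) (WS : forall n, W n.+1 = convol w (W n)).

Let bW n : bm (W n).
Proof. by elim: n => [|n IHn]; rewrite ?W0 // WS; exact: bm_convol. Qed.

Let convW m n : convol (W m) (W n) = W (m + n).+1.
Proof. by elim: m => [|m IHm]; rewrite ?W0 WS // convolA // IHm -WS. Qed.

Let tildeW n : tilde (W n) = W n.
Proof.
by elim: n => [|n IHn]; rewrite ?W0 // WS tilde_convol // w_herm IHn.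
Qed.

Let A n : R := sqnorm (W n).

Let A_E n : (A n)%:C = W (n + n).+1 0.
Proof. by rewrite -convol_tilde0 // tildeW convW. Qed.

Let A_sq n (r : R) : sqmod (W (n + n).+1 0) <= r -> A n ^+ 2 <= r.
Proof. by rewrite -A_E /sqmod /= expr0n addr0. Qed.

Let A_convex n : A n.+1 ^+ 2 <= A n * A n.+2.
Proof.
apply: A_sq; have -> : (n.+1 + n.+1).+1 = (n + n.+2).+1 by rewrite addSn !addnS.
by rewrite -convW; exact: convol_bound.
Qed.

Let A_double n : sqnorm (W (n + n).+1) <= A n ^+ 2.
Proof.
apply: sqnorm_le => // k; rewrite -convW expr2; exact: convol_bound.
Qed.

Let A_submul m n : A (m + n).+1 <= A m * A n.
Proof.
have A0 k : 0 <= A k by exact: sqnorm_ge0.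
have AA0 : 0 <= A m * A n by exact: mulr_ge0.
rewrite -(@ler_pXn2r _ 2) // ?nnegrE //; apply: A_sq.
have -> : ((m + n).+1 + (m + n).+1).+1 = ((m + m).+1 + (n + n).+1).+1.
  by rewrite !addSn !addnS addnACA.
rewrite -convW exprMn; apply: le_trans (convol_bound _ _ _) _ => //.
by apply: ler_pM; rewrite ?A_double // sqnorm_ge0.
Qed.

(** With [W n] the power of [w] of exponent [n.+1], the square norms
    [A n = W (n + n).+1 0] satisfy the hypotheses of [logconvex_submul_growth].
    The rescaled even powers [f n] are closed under convolution and their
    distances in square norm are combinations of values of the convergent
    sequence [B], so they are Cauchy in square norm; one more convolution by
    [f 0] makes them uniformly Cauchy. *)
Lemma power_sequence_projection : 0 < sqnorm (convol w w) ->
  exists E (lam : R), [/\ projection E, 1 <= sqnorm E, 0 < lam &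
    convol (convol w w) E = fun k => lam%:C * E k].
Proof.
move=> A1; have Age0 k : 0 <= A k by exact: sqnorm_ge0.
have A0 : 0 < A 0%N.
  rewrite lt_neqAle Age0 andbT; apply: contraTN A1 => /eqP A00.
  by rewrite -leNgt; move: (A_double 0%N); rewrite WS W0 -A00 expr0n.
have Agt0 n : 0 < A n.
  suff : 0 < A n /\ 0 < A n.+1 by case.
  elim: n => [|n [An An1]]; first by split=> //; rewrite /A WS W0.
  split; first exact: An1.
  have := lt_le_trans (exprn_gt0 2 An1) (A_convex n).
  by rewrite pmulr_rgt0.
have [lam [lam0 [N [N1 BN]]]] := logconvex_submul_growth Agt0 A_convex A_submul.
have lamX n : (lam ^+ n)%:C != 0 :> R[i].
  by rewrite eq_complex /= eqxx andbT expf_neq0 // gt_eqF.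
pose B n := A n / lam ^+ n.+1.
pose f n : K -> R[i] := fun k => ((lam ^+ n.+1)^-1)%:C * W (n + n).+1 k.
have bf n : bm (f n) by rewrite /f; auto.
have f0 n : f n 0 = (B n)%:C.
  by rewrite /f -A_E -rmorphM /= mulrC.
have f_herm n : tilde (f n) = f n.
  by apply/funext => k; rewrite /f /tilde rmorphM -[in RHS]tildeW; congr (_ * _); exact: conjc_real.
have convf m n : convol (f m) (f n) = f (m + n).+1.
  have -> : f (m + n).+1 =
      fun k => ((lam ^+ m.+1 * lam ^+ n.+1)^-1)%:C * W ((m + m).+1 + (n + n).+1).+1 k.
    by rewrite /f -exprD !addSn !addnS addnACA.
  rewrite /f convolZl //; last by auto.
  rewrite convolZr // convW; apply/funext => k.
  by rewrite mulrA -rmorphM invfM.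
have dist i j : sqnorm (fun k => f i k - f j k) =
    B (i + i).+1 + B (j + j).+1 - 2 * B (i + j).+1.
  apply: (@complexI R); rewrite -convol_tilde0; last by auto.
  have -> : tilde (fun k => f i k - f j k) = fun k => f i k - f j k.
    by apply/funext => k; rewrite -{2}f_herm -{2}[f j]f_herm /tilde rmorphB.
  rewrite convolBl; [|by auto|by auto|by auto].
  rewrite !convolBr; [|by auto|by auto|by auto|by auto|by auto|by auto].
  rewrite !convf !f0 addnC [(j + i)%N]addnC.
  by apply: complex_ext; rewrite !ReImE /=; ring.
have [E fE] : exists E, ucvg f E.
  apply: ucauchy_ucvg => e e0.
  pose s := sqnorm (f 0%N); have s0 : 0 <= s by exact: sqnorm_ge0.
  have d0 : 0 < e / (s + 1) / 4 by rewrite !divr_gt0 // ltr_wpDl.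
  have [n0 _ Hn0] := (@cvgrPdist_le _ _ _ _ _ _ _).1 BN _ d0.
  have Bd n : (n0 <= n)%N -> `|N - B n| <= e / (s + 1) / 4 by exact: Hn0.
  exists n0.+1 => -[//|i] [//|j] n0i n0j k; rewrite !ltnS in n0i n0j.
  have -> : f i.+1 k - f j.+1 k = convol (f 0%N) (fun k => f i k - f j k) k.
    by rewrite convolBr // !convf.
  apply: le_trans (convol_bound k (bf 0%N) _) _; first by auto.
  have : sqnorm (fun k => f i k - f j k) <= e / (s + 1).
    rewrite dist.
    have := Bd (i + i).+1 (leq_trans n0i (leq_trans (leq_addr _ _) (leqnSn _))).
    have := Bd (j + j).+1 (leq_trans n0j (leq_trans (leq_addr _ _) (leqnSn _))).
    have := Bd (i + j).+1 (leq_trans n0i (leq_trans (leq_addr _ _) (leqnSn _))).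
    rewrite !ler_norml => /andP[? ?] /andP[? ?] /andP[? ?]; lra.
  move/(ler_wpM2l s0) => /le_trans; apply.
  rewrite mulrCA ler_piMr ?(ltW e0) // ler_pdivrMr ?mul1r ?lerDl //.
  by rewrite ltr_wpDl.
have bE : bm E by exact: ucvg_cbmeas bf fE.
have convfE m : convol (f m) E = E.
  have := ucvg_convol (bf m) bf bE fE.
  under eq_fun do rewrite convf.
  move=> H; apply: (ucvg_unique H).
  apply: (ucvg_shift (s := fun n => (m + n).+1)) fE => n.
  by rewrite (leq_trans (leq_addl m n)).
have convEE : convol E E = E.
  have := ucvg_convol bE bf bE fE.
  under eq_fun do rewrite convolC // convfE.
  move=> H; apply: (ucvg_unique H); exact: ucvg_cst.
have E_herm : tilde E = E.
  have := ucvg_tilde fE; under eq_fun do rewrite f_herm.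
  by move=> H; exact: ucvg_unique H fE.
exists E, lam; split => //.
- have : convol E (tilde E) 0 = (sqnorm E)%:C by exact: convol_tilde0.
  rewrite E_herm convEE => E0.
  have := @ucvg_Re _ _ _ _ 0 fE; rewrite E0 => cE.
  have cE' : B @ \oo --> sqnorm E.
    have -> : B = fun i => Re (f i 0) by apply/funext => i; rewrite f0.
    exact: cE.
  suff -> : sqnorm E = N by [].
  exact: (cvg_unique _ cE' BN).
- rewrite -[E in RHS](convfE 0%N) /f WS W0 convolZl //; last by auto.
  apply/funext => k.
  by rewrite mulrA -rmorphM /= expr1 divff ?mul1r // lt0r_neq0.
Qed.

End powers.

Lemma power_projection w : bm w -> tilde w = w -> 0 < sqnorm (convol w w) ->
  exists E (lam : R), [/\ projection E, 1 <= sqnorm E, 0 < lam &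
    convol (convol w w) E = fun k => lam%:C * E k].
Proof.
move=> bw hw; exact: (@power_sequence_projection w bw hw (fun n => iter n (convol w) w)).
Qed.

End convolution.

(** * From projections to characters *)

Section characters.
Variables (R : realType) (K : topologicalZmodType).
Variable nu : {finite_measure set (borel_group K) -> \bar R}.
Hypothesis K_sc : @second_countable K.
Hypothesis nu_haar : haar_measure nu.
Local Notation Y := (borel_group K).
Implicit Types (u v w E F chi : K -> R[i]).

Let nu_neq0 : nu [set: Y] != 0%E := nu_haar.1.

Local Notation bm u := (cbmeas (u : borel_group K -> _)).
Local Notation sqnorm := (sqnorm nu).
Local Opaque convol.
Local Notation convol := (convol nu).
Local Notation projection := (projection nu).

Let bm_convol_nu u v : bm u -> bm v -> bm (convol u v).
Proof. exact: bm_convol. Qed.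

Local Hint Resolve bm_translate bm_opp bm_reflect bm_tilde bmM bmD bmB bmZ bm_convol_nu : core.

Lemma projection0 E : projection E -> E 0 = (sqnorm E)%:C.
Proof.
by move=> [bE hE EE]; rewrite -[in RHS](convol_tilde0 K_sc nu_haar) // hE EE.
Qed.

Lemma projection_bound E k : projection E -> sqmod (E k) <= sqnorm E ^+ 2.
Proof.
by move=> [bE _ EE]; rewrite -[in leLHS]EE expr2; exact: convol_bound.
Qed.

(** An idempotent satisfies [`|E k| <= sqnorm E], because [E = E * E]; averaging
    the squares shows that its square norm is at most its own square. *)
Lemma projection_ge1 E : projection E -> E = (fun=> 0) \/ 1 <= sqnorm E.
Proof.
move=> pE; have [bE _ _] := pE.
have t0 := sqnorm_ge0 nu E.
have t2 : sqnorm E <= sqnorm E ^+ 2.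
  by apply: sqnorm_le => // k; exact: projection_bound.
have [E0|E0] := eqVneq (sqnorm E) 0; [left|right].
  apply/funext => k; apply/eqP; rewrite -sqmod_eq0 eq_le sqmod_ge0 andbT.
  by have := projection_bound k pE; rewrite E0 expr0n.
have tgt0 : 0 < sqnorm E by rewrite lt_neqAle eq_sym E0.
by move: t2; rewrite expr2 ler_pMl.
Qed.

Lemma projectionB E F : projection E -> projection F -> convol F E = F ->
  projection (fun k => E k - F k) /\
  sqnorm (fun k => E k - F k) = sqnorm E - sqnorm F.
Proof.
move=> pE pF FE; have [[bE hE EE] [bF hF FF]] := (pE, pF).
have EF : convol E F = F by rewrite (convolC K_sc nu_haar).
have pB : projection (fun k => E k - F k).
  split; first by auto.
  - by apply/funext => k; rewrite -[in RHS]hE -[in RHS]hF /tilde rmorphB.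
  - rewrite convolBl; [|by auto|by auto|by auto].
    rewrite !(convolBr K_sc nu_haar) //.
    by rewrite EE EF FE FF; apply/funext => k; rewrite subrr subr0.
split => //; apply: (@complexI R); rewrite -projection0 // rmorphB /=.
by rewrite -!projection0.
Qed.

(** If [w * w] is not null, its top eigenprojection [F] lies below [E]. Either the
    complementary projection [E - F] is nonzero, hence of square norm at least
    1, or [F = E], and then [w * w] acts on the range of [E] as a scalar. *)
Lemma projection_dichotomy E w : projection E -> bm w -> tilde w = w ->
  convol E w = w ->
  (exists F, [/\ projection F, convol F E = F, 1 <= sqnorm F &
    sqnorm F <= sqnorm E - 1]) \/
  exists a : R[i], convol w w = fun k => a * E k.
Proof.
move=> pE bw hw Ew; have [bE hE EE] := pE.
have bww : bm (convol w w) by auto.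
have Eww : convol E (convol w w) = convol w w by rewrite -(convolA K_sc nu_haar) // Ew.
have [ww0|ww0] := eqVneq (sqnorm (convol w w)) 0.
  right; exists 0; apply/funext => k; rewrite mul0r.
  apply/eqP; rewrite -sqmod_eq0 eq_le sqmod_ge0 andbT -Eww.
  by apply: le_trans (convol_bound K_sc nu_haar _ _ _) _; rewrite // ww0 mulr0.
have wwgt0 : 0 < sqnorm (convol w w) by rewrite lt_neqAle eq_sym ww0 sqnorm_ge0.
have [F [lam [pF F1 lam0 wwF]]] := power_projection K_sc nu_haar bw hw wwgt0.
have [bF hF FF] := pF.
have FE : convol F E = F.
  rewrite (convolC K_sc nu_haar) //.
  have wF : F = fun k => (lam^-1)%:C * convol (convol w w) F k.
    rewrite wwF; apply/funext => k.
    by rewrite mulrA -rmorphM /= mulVf ?mul1r ?lt0r_neq0.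
  have bwwF : bm (convol (convol w w) F) by exact: bm_convol_nu.
  rewrite {1}wF (convolZr K_sc nu_haar _ bwwF bE).
  by rewrite -(convolA K_sc nu_haar bE bww bF) Eww -wF.
have [pB sB] := projectionB pE pF FE.
have [EF0|EF1] := projection_ge1 pB; [right|left].
  have EF : E = F.
    by apply/funext => k; apply/eqP; rewrite -subr_eq0 (congr1 (@^~ k) EF0).
  by exists lam%:C; move: wwF; rewrite -EF (convolC K_sc nu_haar bww bE) Eww.
by exists F; split => //; rewrite sB in EF1; lra.
Qed.

Definition measurable_character chi : Prop :=
  [/\ bm chi, forall k, `|chi k| = 1 & forall k l, chi (k + l) = chi k * chi l].

(** A projection without proper subprojections has a range spanned by one
    character: every Hermitian element of the range squares to a multiple of
    [E], hence, polarising with [E], is itself a multiple of [E]; a translate of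
    [E] is a linear combination of two such elements, and so translating [E]
    multiplies it by a scalar. *)
Lemma minimal_projection_character E : projection E -> 1 <= sqnorm E ->
  (forall w, bm w -> tilde w = w -> convol E w = w ->
     exists a : R[i], convol w w = fun k => a * E k) ->
  exists chi, measurable_character chi /\ convol chi E = chi.
Proof.
move=> pE E1 Emin; have [bE hE EE] := pE.
have two0 : (2 : R[i]) != 0 by rewrite pnatr_eq0.
have inCE w : bm w -> tilde w = w -> convol E w = w ->
    exists a : R[i], w = fun k => a * E k.
  move=> bw hw Ew; have [a wwa] := Emin w bw hw Ew.
  have bwE : bm (fun k => w k + E k) by auto.
  have hwE : tilde (fun k => w k + E k) = fun k => w k + E k.
    by apply/funext => k; rewrite -[in RHS]hw -[in RHS]hE /tilde rmorphD.
  have EwE : convol E (fun k => w k + E k) = fun k => w k + E k.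
    by rewrite (convolDr K_sc nu_haar bw bE bE) Ew EE.
  have [b] := Emin _ bwE hwE EwE.
  rewrite (convolDl nu bw bE bwE) (convolDr K_sc nu_haar bw bE bw).
  rewrite (convolDr K_sc nu_haar bw bE bE) wwa (convolC K_sc nu_haar bw bE) Ew EE.
  move=> H; exists ((b - a - 1) / 2); apply/funext => k.
  have := congr1 (@^~ k) H => /= Hk.
  have -> : w k = (a * E k + w k + (w k + E k) - a * E k - E k) / 2 by field.
  by rewrite Hk; field.
have ci : ('i%C : R[i])^*%C = - 'i%C by apply: complex_ext; rewrite !ReImE /= ?oppr0.
have ii : 'i%C * 'i%C = -1 :> R[i] by rewrite -expr2 sqr_i.
have tau a : exists s : R[i], forall k, E (a + k) = s * E k.
  (* Ep + Em and 'i (Ep - Em) are Hermitian, as the involution exchanges Ep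
     and Em. *)
  pose Ep k := E (a + k); pose Em k := E (- a + k).
  have bp : bm Ep by rewrite /Ep; auto.
  have bq : bm Em by rewrite /Em; auto.
  have hp k : (Ep (- k))^*%C = Em k.
    by rewrite /Ep /Em -[in RHS]hE /tilde opprD opprK.
  have hq k : (Em (- k))^*%C = Ep k.
    by rewrite /Ep /Em -[in RHS]hE /tilde opprD.
  have Econv b : convol E (fun k => E (b + k)) = fun k => E (b + k).
    have bb := bm_translate b bE.
    by rewrite (convolC K_sc nu_haar bE bb) convol_translate EE.
  have [r Hr] : exists r : R[i], (fun k => Ep k + Em k) = fun k => r * E k.
    apply: inCE; first by auto.
      by apply/funext => k; rewrite /tilde conjcD hp hq addrC.
    by rewrite (convolDr K_sc nu_haar bp bq bE) !Econv.
  have [t Ht] : exists t : R[i], (fun k => 'i%C * (Ep k - Em k)) = fun k => t * E k.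
    apply: inCE; first by auto.
      by apply/funext => k; rewrite /tilde conjcM conjcB hp hq ci; ring.
    rewrite (convolZr K_sc nu_haar _ (bmB bp bq) bE).
    by rewrite (convolBr K_sc nu_haar bp bq bE) !Econv.
  exists ((r - 'i%C * t) / 2) => k; rewrite -/(Ep k).
  have := congr1 (@^~ k) Hr; have := congr1 (@^~ k) Ht => /= Htk Hrk.
  have -> : (r - 'i%C * t) / 2 * E k = (r * E k - 'i%C * (t * E k)) / 2 by field.
  rewrite -Hrk -Htk mulrA ii; by field.
have E0 := projection0 pE.
have sE : sqnorm E != 0 by rewrite gt_eqF // (lt_le_trans ltr01).
have E0n : E 0 != 0 by rewrite E0 eq_complex /= eqxx andbT.
have EM a k : E (a + k) * E 0 = E a * E k.
  by have [s sE'] := tau a; rewrite -{2}[a]addr0 !sE'; ring.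
pose chi k := (E 0)^-1 * E k.
have chiM k l : chi (k + l) = chi k * chi l.
  rewrite /chi.
  have -> : (E 0)^-1 * E k * ((E 0)^-1 * E l) = (E 0)^-1 ^+ 2 * (E k * E l) by ring.
  by rewrite -EM; field.
have chi0 : chi 0 = 1 by rewrite /chi mulVf.
have chi_le1 k : sqmod (chi k) <= 1.
  rewrite /chi sqmodM.
  have -> : 1 = sqmod (E 0)^-1 * sqmod (E 0) by rewrite -sqmodM mulVf // sqmod1.
  rewrite ler_wpM2l ?sqmod_ge0 // (le_trans (projection_bound k pE)) //.
  by rewrite E0 /sqmod /= expr0n addr0.
exists chi; split; last by rewrite /chi (convolZl nu _ bE bE) EE.
split => [|k|//]; first by rewrite /chi; auto.
apply/sqmod_normP; rewrite eq_le chi_le1 /=.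
have : sqmod (chi k) * sqmod (chi (- k)) = 1.
  by rewrite -sqmodM -chiM subrr chi0 sqmod1.
have := chi_le1 (- k); have := sqmod_ge0 (chi k); have := sqmod_ge0 (chi (- k)).
nra.
Qed.

(** Replacing [E] by a proper subprojection lowers its square norm by at least
    1, and the square norm stays at least 1, so this descent ends at a minimal
    projection. *)
Lemma projection_character E : projection E -> 1 <= sqnorm E ->
  exists chi, measurable_character chi /\ convol chi E = chi.
Proof.
have [n] : exists n : nat, sqnorm E <= n%:R.
  exists (Num.truncn (sqnorm E)).+1; exact/ltW/truncnS_gt.
elim: n E => [|n IHn] E En pE E1; first by move: (le_trans E1 En); rewrite ler10.
have [[F [pF FE F1 FE1]]|noF] := pselect (exists F, [/\ projection F, convol F E = F,
    1 <= sqnorm F & sqnorm F <= sqnorm E - 1]).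
  have [|//|//|chi [chic chiF]] := IHn F.
    by move: En; rewrite -natr1 -lerBlDr; exact: le_trans FE1.
  exists chi; split; first exact: chic.
  have [[[bchi _ _] [bE _ _]] [bF _ _]] := (chic, pE, pF).
  by rewrite -[in LHS]chiF (convolA K_sc nu_haar bchi bF bE) FE chiF.
apply: minimal_projection_character => // w bw hw Ew.
by have [] := projection_dichotomy pE bw hw Ew.
Qed.

End characters.

(** * Characters separate measurable sets *)

Section peter_weyl.
Variables (R : realType) (K : topologicalZmodType).
Variable nu : {finite_measure set (borel_group K) -> \bar R}.
Hypothesis K_sc : @second_countable K.
Hypothesis nu_haar : haar_measure nu.
Local Notation Y := (borel_group K).
Implicit Types (u v w chi : K -> R[i]).

Let nu_neq0 : nu [set: Y] != 0%E := nu_haar.1.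

Local Notation bm u := (cbmeas (u : borel_group K -> _)).
Local Notation sqnorm := (sqnorm nu).
Local Opaque convol.
Local Notation convol := (convol nu).

Let bm_convol_nu u v : bm u -> bm v -> bm (convol u v).
Proof. exact: bm_convol. Qed.

Local Hint Resolve bm_translate bm_opp bm_reflect bm_tilde bmM bmD bmB bmZ bm_convol_nu : core.

Definition L2_shift_continuous u : Prop := forall e : R, 0 < e ->
  nbhs (0 : K) [set a | sqnorm (fun k => u (a + k) - u k) <= e].

Definition unif_continuous u : Prop := forall e : R, 0 < e ->
  nbhs (0 : K) [set a | forall k, sqmod (u (a + k) - u k) <= e].

Lemma unif_continuous_L2 u : bm u -> unif_continuous u -> L2_shift_continuous u.
Proof.
move=> bu cu e e0; apply: filterS (cu e e0) => a /= H.
exact: (sqnorm_le nu_neq0 (bmB (bm_translate a bu) bu)).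
Qed.

Lemma unif_continuous_convol u v : bm u -> bm v -> L2_shift_continuous u ->
  unif_continuous (convol u v).
Proof.
move=> bu bv cu e e0; have s0 := sqnorm_ge0 nu v.
have d0 : 0 < e / (sqnorm v + 1) by rewrite divr_gt0 // ltr_wpDl.
apply: filterS (cu _ d0) => a /= H k.
have bau : bm (fun k => u (a + k)) by auto.
have -> : convol u v (a + k) - convol u v k = convol (fun k => u (a + k) - u k) v k.
  by rewrite (convolBl nu bau bu bv) convol_translate.
apply: le_trans (convol_bound K_sc nu_haar k (bmB bau bu) bv) _.
apply: le_trans (ler_wpM2r s0 H) _.
have s1 : 0 < sqnorm v + 1 by rewrite ltr_wpDl //.
by rewrite mulrAC ler_pdivrMr // ler_wpM2l ?(ltW e0) // lerDl.
Qed.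

Lemma indic_L2_shift_continuous (B : set Y) (t : R) : measurable B ->
  L2_shift_continuous (fun k => (\1_B k - t)%:C).
Proof.
move=> mB e e0.
have [_ /(_ e e0)] := shift_continuous_measurable K_sc nu_haar mB.
apply: filterS => a /=; congr (_ <= _); congr rmean; apply/funext => k.
rewrite -rmorphB /sqmod /= expr0n addr0 !indicE.
by case: (_ \in B); case: (_ \in B);
  rewrite /= ?subrr ?sub0r ?subr0 ?normrN ?normr1 ?normr0; ring.
Qed.

Lemma unif_continuous_sqnorm_gt0 u : bm u -> unif_continuous u -> u 0 != 0 ->
  0 < sqnorm u.
Proof.
move=> bu cu u0.
have s0 : 0 < sqmod (u 0) by rewrite lt_neqAle eq_sym sqmod_eq0 u0 sqmod_ge0.
have := cu (sqmod (u 0) / 4) (divr_gt0 s0 (ltr0n _ 4)).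
rewrite nbhsE => -[V [oV V0] Vu].
have mV : measurable (V : set Y) by exact: borel_open.
have VK : 0 < rmean nu (\1_V : Y -> R).
  rewrite rmean_indic // divr_gt0 ?nuT_gt0 // lt_neqAle fine_ge0 // andbT.
  apply: contra (open_measure_neq0 K_sc nu_haar oV V0) => /eqP V00.
  by rewrite -[nu _]fineK ?fin_num_measure // -V00.
apply: (@lt_le_trans _ _ (sqmod (u 0) / 4 * rmean nu (\1_V : Y -> R))).
  by rewrite mulr_gt0 // divr_gt0.
rewrite -rmeanZ; last exact: bmeas_indic.
apply: rmean_le; first by apply: bmeasM; [exact: bmeas_cst|exact: bmeas_indic].
  exact: bmeas_sqmod.
move=> k; rewrite indicE; case: (boolP (k \in _)) => [|_]; last first.
  by rewrite mulr0 sqmod_ge0.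
rewrite inE mulr1 => /Vu /(_ 0); rewrite addr0 sqmodB => H.
have := sqmodD_le (u 0 - u k) (u k); rewrite subrK; lra.
Qed.

Lemma unif_continuous_continuous u : unif_continuous u -> continuous u.
Proof.
move=> cu k U /(@nbhs_ballP _ R[i]^o)[e /= e0 eU].
have [r r0 re] : exists2 r : R, 0 < r & r%:C = e.
  exists (Re e); first by move: e0; rewrite ltcE => /andP[].
  by rewrite RRe_real // gtr0_real.
have r2 : 0 < (r / 2) ^+ 2 by rewrite exprn_gt0 // divr_gt0.
have : nbhs k ((fun l => - k + l) @^-1` [set a | forall l, sqmod (u (a + l) - u l) <= (r / 2) ^+ 2]).
  by apply: translation_continuous; rewrite addNr; exact: cu.
apply: filterS => l /= /(_ k); rewrite addrAC addNr add0r => H.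
apply: eU; rewrite /ball /= -re ltc_sqmod ?(ltW r0) // sqmodB.
apply: le_lt_trans H _; rewrite ltr_pXn2r ?nnegrE ?divr_ge0 ?(ltW r0) //.
by rewrite ltr_pdivrMr // ltr_pMr // ltr1n.
Qed.

Lemma dual_bm chi : pontryagin_dual chi -> bm chi.
Proof. by move=> [cchi chi1 _]; exact: continuous_cbmeas. Qed.

Lemma character0 chi : (forall k, `|chi k| = 1) ->
  (forall k l, chi (k + l) = chi k * chi l) -> chi 0 = 1.
Proof.
move=> chi1 chiM; have := chiM 0 0; rewrite addr0 => /eqP.
have c0 : chi 0 != 0 by rewrite -normr_gt0 chi1.
by rewrite -[X in X == _]mulr1 (inj_eq (mulfI c0)) eq_sym => /eqP.
Qed.

Lemma characterN chi k : (forall k, `|chi k| = 1) ->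
  (forall k l, chi (k + l) = chi k * chi l) -> chi (- k) = (chi k)^*%C.
Proof.
move=> chi1 chiM; have c0 := character0 chi1 chiM.
have k0 : chi k != 0 by rewrite -normr_gt0 chi1.
by apply: (mulfI k0); rewrite -chiM subrr c0 mulJ1.
Qed.

Lemma mean_character chi : pontryagin_dual chi -> chi <> (fun=> 1) -> mean nu chi = 0.
Proof.
move=> dchi nchi; have [_ _ chiM] := dchi.
have [a na] : exists a, chi a != 1.
  apply: contrapT => H; apply: nchi; apply/funext => a.
  by apply/eqP/negP => /negP na; apply: H; exists a.
have := mean_translate nu_haar a (dual_bm dchi).
under eq_fun do rewrite chiM.
rewrite meanZ; last exact: dual_bm.
move/eqP; rewrite -subr_eq0 -{2}[mean nu chi]mul1r -mulrBl mulf_eq0 subr_eq0.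
by rewrite (negbTE na) /= => /eqP.
Qed.

Lemma convol_character u chi : bm u -> measurable_character chi ->
  convol u chi = fun k => mean nu (fun l => u l * (chi l)^*%C) * chi k.
Proof.
move=> bu [bchi chi1 chiM]; rewrite (convolC K_sc nu_haar bu bchi).
apply/funext => k; rewrite -meanZr; last by apply: bmM => //; exact: cbmeasJ.
rewrite [LHS]/(mean nu (fun l => chi (k - l) * u l)); congr mean; apply/funext => l.
by rewrite chiM characterN //; ring.
Qed.

(** Let [u] be the indicator of [B] minus its mean and let [w = u * u~]. The
    function [w] is continuous, and so is [w * w]; this is what guarantees that
    [w * w] is not null, as its value at 0 is the square norm of [w]. A
    character [chi] below the top eigenprojection of [w * w] satisfies
    [(w * w) * chi = lam chi] with [lam > 0]. This makes [chi] continuous, and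
    [chi] cannot be orthogonal to [u], since [u * chi] is the multiple of [chi]
    by the coefficient of [u] at [chi]. *)
Lemma character_of_set (B : set Y) : measurable B -> nu B != 0%E -> nu (~` B) != 0%E ->
  exists2 chi : K -> R[i], pontryagin_dual chi /\ chi <> (fun=> 1) &
    mean nu (fun k => (\1_B k)%:C * (chi k)^*%C) != 0.
Proof.
move=> mB B0 CB0.
pose t := rmean nu (\1_B : Y -> R).
have bB : bmeas (\1_B : Y -> R) by exact: bmeas_indic.
have bB' : bm (fun k => (\1_B k)%:C) := cbmeas_real bB.
have fine_gt0 (A : set Y) : measurable A -> nu A != 0%E -> 0 < rmean nu (\1_A : Y -> R).
  move=> mA A0; rewrite rmean_indic // divr_gt0 ?nuT_gt0 // lt_neqAle fine_ge0 // andbT.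
  apply: contra A0 => /eqP A00.
  by rewrite -[nu _]fineK ?fin_num_measure // -A00.
have t0 : 0 < t by exact: fine_gt0.
have t1 : t < 1.
  rewrite -subr_gt0; have := fine_gt0 _ (measurableC mB) CB0.
  congr (_ < _); rewrite -[1](rmean_cst nu_neq0) -rmeanB //; last exact: bmeas_cst.
  congr rmean; apply/funext => k; rewrite !indicE in_setC.
  by case: (k \in B); rewrite ?subrr ?subr0.
pose u : K -> R[i] := fun k => (\1_B k - t)%:C.
have bu : bm u.
  by apply: cbmeas_real; apply: bmeasB => //; exact: bmeas_cst.
have cu : L2_shift_continuous u by exact: indic_L2_shift_continuous.
have bu' := bm_tilde bu.
pose w := convol u (tilde u).
have bw : bm w by exact: bm_convol_nu.
have hw : tilde w = w.
  by rewrite /w (tilde_convol K_sc nu_haar bu bu') tildeK (convolC K_sc nu_haar bu' bu).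
have cw : unif_continuous w by exact: unif_continuous_convol.
have sqnu : 0 < sqnorm u.
  have -> : sqnorm u = t * (1 - t).
    have -> : sqnorm u = rmean nu (fun k => (1 - 2 * t) * \1_B k + t ^+ 2).
      congr rmean; apply/funext => k; rewrite /u /sqmod /= expr0n addr0 !indicE.
      by case: (k \in B) => /=; ring.
    rewrite rmeanD; [|by apply: bmeasM => //; exact: bmeas_cst|exact: bmeas_cst].
    by rewrite (rmeanZ nu _ bB) (rmean_cst nu_neq0) -/t; ring.
  by rewrite mulr_gt0 // subr_gt0.
have c_neq0 (r : R) : 0 < r -> r%:C != 0 by move=> r0; rewrite eq_complex /= gt_eqF.
have sqnw : 0 < sqnorm w.
  apply: unif_continuous_sqnorm_gt0 => //.
  by rewrite /w (convol_tilde0 K_sc nu_haar bu) c_neq0.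
have bww : bm (convol w w) by exact: bm_convol_nu.
have cww : unif_continuous (convol w w).
  by apply: unif_continuous_convol => //; exact: unif_continuous_L2.
have sqnww : 0 < sqnorm (convol w w).
  apply: unif_continuous_sqnorm_gt0 => //.
  by rewrite -{2}hw (convol_tilde0 K_sc nu_haar bw) c_neq0.
have [E [lam [pE E1 lam0 wwE]]] := power_projection K_sc nu_haar bw hw sqnww.
have [chi [mchi chiE]] := projection_character K_sc nu_haar pE E1.
have [bE _ _] := pE; have [bchi chi1 chiM] := mchi.
have wwchi : convol (convol w w) chi = fun k => lam%:C * chi k.
  rewrite -[in LHS]chiE (convolC K_sc nu_haar bchi bE).
  rewrite -(convolA K_sc nu_haar bww bE bchi) wwE (convolZl nu _ bE bchi).
  by rewrite (convolC K_sc nu_haar bE bchi) chiE.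
have cchi : continuous chi.
  apply: unif_continuous_continuous.
  have -> : chi = convol (convol w w) (fun k => (lam^-1)%:C * chi k).
    rewrite (convolZr K_sc nu_haar _ bchi bww) wwchi; apply/funext => k.
    by rewrite mulrA -rmorphM mulVf ?mul1r // lt0r_neq0.
  apply: unif_continuous_convol => //; first by auto.
  exact: unif_continuous_L2.
have dchi : pontryagin_dual chi by split.
have uchi : mean nu (fun l => u l * (chi l)^*%C) != 0.
  apply/eqP => uchi0.
  have uc : convol u chi = fun=> 0.
    by rewrite (convol_character bu mchi) uchi0; apply/funext => k; rewrite mul0r.
  have wc : convol w chi = fun=> 0.
    rewrite /w (convolC K_sc nu_haar bu bu') (convolA K_sc nu_haar bu' bu bchi) uc.
    have b0 : bm (fun _ : K => 0) := @cbmeas_cst R _ Y 0.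
    have := convolZr K_sc nu_haar 0 b0 bu'.
    by rewrite mul0r => ->; apply/funext => k; rewrite mul0r.
  have : convol (convol w w) chi 0 = 0.
    rewrite (convolA K_sc nu_haar bw bw bchi) wc.
    have b0 : bm (fun _ : K => 0) := @cbmeas_cst R _ Y 0.
    have := convolZr K_sc nu_haar 0 b0 bw.
    by rewrite mul0r => ->; rewrite mul0r.
  rewrite wwchi (character0 chi1 chiM) mulr1 => /eqP.
  by rewrite (negbTE (c_neq0 _ lam0)).
have bchiJ : bm (fun l => (chi l)^*%C) by exact: cbmeasJ.
have muchi : mean nu (fun l => u l * (chi l)^*%C) =
    mean nu (fun k => (\1_B k)%:C * (chi k)^*%C) - t%:C * (mean nu chi)^*%C.
  rewrite -meanJ // -meanZ // -meanB; [|by auto|by auto].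
  by congr mean; apply/funext => k; rewrite /u rmorphB mulrBl.
have nchi : chi <> fun=> 1.
  move=> chi_1; move: uchi; rewrite muchi chi_1 mean_cst // conjc1.
  rewrite [X in mean nu X](_ : _ = fun k : Y => (\1_B k)%:C).
    by rewrite mean_real mulr1 subrr eqxx.
  by apply/funext => k; rewrite mulr1.
exists chi => //; move: uchi.
by rewrite muchi (mean_character dchi nchi) conjc0 mulr0 subr0.
Qed.

(** * Bessel's inequality and the countability of the dual *)

Lemma dual_mulJ chi psi : pontryagin_dual chi -> pontryagin_dual psi ->
  pontryagin_dual (fun k => chi k * (psi k)^*%C).
Proof.
move=> dchi dpsi; have [cchi chi1 chiM] := dchi; have [cpsi psi1 psiM] := dpsi.
split.
- have -> : (fun k => chi k * (psi k)^*%C) = fun k => chi k * psi (- k).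
    by apply/funext => k; rewrite characterN.
  move=> k; apply: (@cvgM R[i] K (nbhs k)); first exact: cchi.
  by apply: continuous_comp; [exact: opp_continuous|exact: cpsi].
- by move=> k; rewrite normrM normcJ chi1 psi1 mulr1.
- by move=> k l; rewrite chiM psiM conjcM; ring.
Qed.

Lemma character_orthogonality chi psi : pontryagin_dual chi -> pontryagin_dual psi ->
  chi <> psi -> mean nu (fun k => chi k * (psi k)^*%C) = 0.
Proof.
move=> dchi dpsi npsi; apply: mean_character; first exact: dual_mulJ.
move=> H; apply: npsi; apply/funext => k.
have [_ psi1 _] := dpsi.
have := congr1 (@^~ k) H => /= Hk.
by rewrite -[LHS]mulr1 -(mulJ1 (psi1 k)) [psi k * _]mulrC mulrA Hk mul1r.
Qed.

Lemma character_sqnorm chi : pontryagin_dual chi ->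
  mean nu (fun k => chi k * (chi k)^*%C) = 1.
Proof.
move=> [_ chi1 _]; under eq_fun do rewrite mulJ1 //.
exact: mean_cst.
Qed.

Definition fourier u chi : R[i] := mean nu (fun k => u k * (chi k)^*%C).

Lemma bessel u (s : seq (K -> R[i])) : bm u -> uniq s ->
  (forall chi, chi \in s -> pontryagin_dual chi) ->
  \sum_(chi <- s) sqmod (fourier u chi) <= sqnorm u.
Proof.
move=> bu.
(* The induction carries along the remainder v of u after its components along
   s have been removed, whose coefficients off s are those of u. *)
suff H : uniq s -> (forall chi, chi \in s -> pontryagin_dual chi) ->
   let v := fun k => u k - \sum_(chi <- s) fourier u chi * chi k in
   [/\ bm v, sqnorm v = sqnorm u - \sum_(chi <- s) sqmod (fourier u chi) &
    forall psi, pontryagin_dual psi -> psi \notin s -> fourier v psi = fourier u psi].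
  move=> us ds; have [_ sv _] := H us ds.
  by rewrite -subr_ge0 -sv sqnorm_ge0.
elim: s => [_ _|chi s IHs /= /andP[chis us] ds] /=.
  have -> : (fun k => u k - \sum_(chi <- [::]) fourier u chi * chi k) = u.
    by apply/funext => k; rewrite big_nil subr0.
  by rewrite big_nil subr0.
have dchi : pontryagin_dual chi by apply: ds; rewrite mem_head.
have [|bv sv fv] := IHs us.
  by move=> psi psis; apply: ds; rewrite in_cons psis orbT.
move: bv sv fv; set v := fun k => u k - _ => bv sv fv.
have -> : (fun k => u k - \sum_(chi <- chi :: s) fourier u chi * chi k) =
   fun k => v k - fourier u chi * chi k.
  by apply/funext => k; rewrite big_cons opprD addrCA addrC.
set a := fourier u chi.
have fvchi : mean nu (fun k => v k * (chi k)^*%C) = a by exact: fv.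
have bchi := dual_bm dchi.
have bchiJ : bm (fun l => (chi l)^*%C) by exact: cbmeasJ.
have bvJ : bm (fun l => (v l)^*%C) by exact: cbmeasJ.
have b1 : bm (fun k => v k * (v k)^*%C) := bmM bv bvJ.
have b2 : bm (fun k => v k * (chi k)^*%C) := bmM bv bchiJ.
have b3 : bm (fun k => (v k * (chi k)^*%C)^*%C) := cbmeasJ b2.
have b4 : bm (fun k => chi k * (chi k)^*%C) := bmM bchi bchiJ.
split; first exact: (bmB bv (bmZ a bchi)).
- rewrite big_cons -/a opprD addrCA -sv; apply: (@complexI R).
  rewrite -mean_mulJ.
  have -> : (fun k => (v k - a * chi k) * (v k - a * chi k)^*%C) =
     fun k => (v k * (v k)^*%C - a^*%C * (v k * (chi k)^*%C)) -
              (a * (v k * (chi k)^*%C)^*%C - a * a^*%C * (chi k * (chi k)^*%C)).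
    by apply/funext => k; rewrite conjcB !conjcM conjcK; ring.
  rewrite (meanB nu (bmB b1 (bmZ _ b2)) (bmB (bmZ _ b3) (bmZ _ b4))).
  rewrite (meanB nu b1 (bmZ _ b2)) (meanB nu (bmZ _ b3) (bmZ _ b4)).
  rewrite (meanZ nu _ b2) (meanZ nu _ b3) (meanZ nu _ b4) (meanJ nu b2).
  rewrite (character_sqnorm dchi) fvchi mulr1 subrr subr0.
  by rewrite mean_mulJ [a^*%C * a]mulrC mulJ -rmorphB addrC.
- move=> psi dpsi; rewrite in_cons negb_or => /andP[npsi psis].
  rewrite -(fv psi dpsi psis) /fourier.
  have bpsiJ : bm (fun l => (psi l)^*%C) by apply: cbmeasJ; exact: dual_bm.
  have -> : (fun k => (v k - a * chi k) * (psi k)^*%C) =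
     fun k => v k * (psi k)^*%C - a * (chi k * (psi k)^*%C).
    by apply/funext => k; ring.
  rewrite (meanB nu (bmM bv bpsiJ) (bmZ a (bmM bchi bpsiJ))).
  have chipsi : chi <> psi by move=> cp; move: npsi; rewrite cp eqxx.
  rewrite (meanZ nu a (bmM bchi bpsiJ)).
  by rewrite (character_orthogonality dchi dpsi chipsi) mulr0 subr0.
Qed.

Lemma bessel_finite u (e : R) (A : set (K -> R[i])) : bm u -> 0 < e ->
  A `<=` @pontryagin_dual R K -> (forall chi, A chi -> e <= sqmod (fourier u chi)) ->
  finite_set A.
Proof.
move=> bu e0 Ad Ae; apply: contrapT => infA.
pose n := (Num.truncn (sqnorm u / e)).+1.
have [B BA nB] := infinite_set_fset n infA.
have BA' chi : chi \in finmap.enum_fset B -> A chi by exact: BA.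
have := bessel bu (finmap.fset_uniq B) (fun chi Bchi => Ad _ (BA' _ Bchi)).
have le_sum : n%:R * e <= \sum_(chi <- finmap.enum_fset B) sqmod (fourier u chi).
  apply: (@le_trans _ _ ((size (finmap.enum_fset B))%:R * e)).
    by rewrite ler_pM2r // ler_nat.
  elim: (finmap.enum_fset B) BA' => [|chi s IHs] sA; first by rewrite big_nil mul0r.
  rewrite big_cons /= -natr1 mulrDl mul1r addrC lerD ?Ae //.
    by apply: sA; rewrite mem_head.
  by apply: IHs => psi psis; apply: sA; rewrite in_cons psis orbT.
move/(le_trans le_sum); rewrite -ler_pdivlMr //.
by rewrite leNgt truncnS_gt.
Qed.

(** By Bessel, for a fixed open set [B] only finitely many characters have a
    Fourier coefficient of [\1_B] above a given threshold; and every character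
    has a nonzero coefficient at the indicator of some member of a countable
    base, namely one that sits inside the set where its real part exceeds 1/2. *)
Lemma countable_dual : countable (@pontryagin_dual R K).
Proof.
have [b [bo bb]] := countable_base K_sc.
have mb n : measurable (b n : set Y) by exact: borel_open.
have bmb n : bmeas (\1_(b n) : Y -> R) by exact: bmeas_indic.
pose u n : K -> R[i] := fun k => (\1_(b n) k)%:C.
have bu n : bm (u n) := cbmeas_real (bmb n).
have squ n : sqnorm (u n) <= 1.
  apply: (sqnorm_le nu_neq0 (bu n)) => k.
  by rewrite /u /sqmod /= expr0n addr0 indicE expr_le1 // lern1 leq_b1.
pose S n m := [set chi : K -> R[i] | pontryagin_dual chi /\
  m.+1%:R^-1 <= sqmod (fourier (u n) chi)].
have finS n m : finite_set (S n m).
  by apply: (bessel_finite (bu n) (e := m.+1%:R^-1)) => [|chi []|chi []].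
apply: (@sub_countable _ _ _ (\bigcup_n \bigcup_m S n m)); last first.
  by apply: bigcup_countable => // n _; apply: bigcup_countable => // m _;
    exact: finite_set_countable.
apply: subset_card_le => chi dchi; have [cchi chi1 chiM] := dchi.
have [n [n0 nchi]] : exists n, b n 0 /\ b n `<=` [set k | 1 / 2 < Re (chi k)].
  apply: bb; apply: (open_nbhs_nbhs (conj _ _)); last first.
    by rewrite /= (character0 chi1 chiM) /=; lra.
  have cR : continuous (fun k => Re (chi k)).
    by move=> k; apply: continuous_comp; [exact: cchi|exact: Re_continuous].
  have -> : [set k | 1 / 2 < Re (chi k)] = (fun k => Re (chi k)) @^-1` `]1 / 2, +oo[.
    by apply/seteqP; split => k; rewrite /= in_itv /= andbT.
  by apply: open_comp_preimage => //; exact: interval_open.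
have f0 : fourier (u n) chi != 0.
  suff : 0 < Re (fourier (u n) chi).
    by move=> H; apply/eqP => H0; rewrite H0 /= ltxx in H.
  apply: (@lt_le_trans _ _ (1 / 2 * rmean nu (\1_(b n) : Y -> R))).
    rewrite mulr_gt0 ?divr_gt0 // rmean_indic // divr_gt0 ?nuT_gt0 //.
    rewrite lt_neqAle fine_ge0 // andbT.
    apply: contra (open_measure_neq0 K_sc nu_haar (bo n) n0) => /eqP V00.
    by rewrite -[nu _]fineK ?fin_num_measure // -V00.
  rewrite -rmeanZ //; apply: rmean_le.
  - by apply: bmeasM => //; exact: bmeas_cst.
  - by case: (bmM (bu n) (cbmeasJ (dual_bm dchi))).
  - move=> k; rewrite /u !ReImE /= mul0r subr0 indicE.
    case: (boolP (k \in _)); last by rewrite mulr0 mul0r.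
    by rewrite inE => /nchi /= /ltW; rewrite !mulr1 !mul1r.
have p0 : 0 < sqmod (fourier (u n) chi).
  by rewrite lt_neqAle eq_sym sqmod_eq0 f0 sqmod_ge0.
exists n => //; exists (Num.truncn (sqmod (fourier (u n) chi))^-1) => //; split => //.
rewrite -[leRHS]invrK lef_pV2 ?posrE ?invr_gt0 //.
exact/ltW/truncnS_gt.
Qed.

End peter_weyl.

(** * Null sets and ergodicity *)

Section almost_everywhere.
Context (R : realType) d (X : measurableType d).

Lemma ae_countable (mu : {measure set X -> \bar R}) (I : Type) (D : set I)
    (P : I -> X -> Prop) : countable D ->
  (forall i, D i -> {ae mu, forall x, P i x}) ->
  {ae mu, forall x, forall i, D i -> P i x}.
Proof.
move=> /countable_injP[f finj] DP.
pose N n : set X := [set x | exists i, [/\ D i, f i = n & ~ P i x]].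
have N0 n : mu.-negligible (N n).
  have [[i [Di fi]]|noi] := pselect (exists i, D i /\ f i = n).
    apply: negligibleS (DP i Di) => x [j [Dj fj nPj]] Pi; apply: nPj.
    by rewrite (finj j i) ?inE // fj fi.
  apply: negligibleS (negligible_set0 mu) => x [i [Di fi _]].
  by apply: noi; exists i.
apply: negligibleS (negligible_bigcup N0) => x /= nP.
apply: contrapT => xN; apply: nP => i Di; apply: contrapT => nPi.
by apply: xN; exists (f i) => //; exists i.
Qed.

Lemma ae_exists (mu : {measure set X -> \bar R}) (P : X -> Prop) :
  mu [set: X] != 0%E -> {ae mu, forall x, P x} -> exists x, P x.
Proof.
move=> mu0 aeP; apply: contrapT => nP; move/eqP: mu0; apply.
apply: measure_negligible => //.
by apply: negligibleS aeP => x _ Px; apply: nP; exists x.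
Qed.

Lemma ae_preserving (mu : {measure set X -> \bar R}) (h : X -> X) (P : X -> Prop) :
  measurable_fun [set: X] h ->
  (forall A, measurable A -> mu (h @^-1` A) = mu A) ->
  {ae mu, forall x, P x} -> {ae mu, forall x, P (h x)}.
Proof.
move=> mh muh [N [mN N0 PN]]; exists (h @^-1` N); split.
- by rewrite -[X in measurable X]setTI; exact: mh.
- by rewrite muh.
- by move=> x /= nPhx; apply: PN.
Qed.

(** Each sublevel set is null or conull; the constant is the supremum of the
    levels whose sublevel set is null. *)
Lemma ergodic_constant (mu : {measure set X -> \bar R}) (G : Type)
    (a : G -> X -> X) (H : set G) (T : X -> R) :
  mu [set: X] != 0%E -> ergodic mu a H -> bmeas T ->
  (forall g, H g -> {ae mu, forall x, T (a g x) = T x}) ->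
  exists C, {ae mu, forall x, T x = C}.
Proof.
move=> mu0 erg [mT [M TM]] Tinv.
have mlt q : measurable [set x | T x < q].
  have -> : [set x | T x < q] = [set: X] `&` T @^-1` `]-oo, q[.
    by rewrite setTI; apply/seteqP; split => x; rewrite /= in_itv.
  exact: mT.
have dich q : mu [set x | T x < q] = 0%E \/ mu (~` [set x | T x < q]) = 0%E.
  apply: erg => // g Hg; apply: filterS (Tinv g Hg) => x /=.
  by move=> ->.
pose D := [set q | mu [set x | T x < q] = 0%E].
have DM : D (- M).
  rewrite /D /= (_ : [set x | _] = set0) ?measure0 //.
  apply/seteqP; split => x //=; have := TM x; rewrite ler_norml => /andP[? _].
  by rewrite ltNge => /negP.
have D_ub : ubound D (M + 1).
  move=> q Dq; rewrite leNgt; apply/negP => Mq; move/eqP: mu0; apply.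
  rewrite -Dq; congr (mu _); apply/seteqP; split => x //= _.
  apply: le_lt_trans (ler_norm _) _; apply: le_lt_trans (TM x) _.
  by apply: lt_trans Mq; rewrite ltrDl.
have D_sup : has_sup D by split; [exists (- M)|exists (M + 1)].
have D_down q q' : q' <= q -> D q -> D q'.
  move=> qq' Dq; apply/eqP; rewrite -measure_le0 -Dq le_measure ?inE //.
  by move=> x /= /lt_le_trans; apply.
exists (sup D).
pose N n := [set x | T x < sup D - n.+1%:R^-1] `|`
            ~` [set x | T x < sup D + n.+1%:R^-1].
have N0 n : mu.-negligible (N n).
  have n0 : 0 < n.+1%:R^-1 :> R by rewrite invr_gt0.
  apply: negligibleU.
    exists [set x | T x < sup D - n.+1%:R^-1]; split => //.
    have [q Dq qs] := sup_adherent n0 D_sup.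
    by apply: D_down Dq; exact: ltW.
  exists (~` [set x | T x < sup D + n.+1%:R^-1]); split => //.
    exact: measurableC.
  have [Dq|//] := dich (sup D + n.+1%:R^-1).
  have : sup D + n.+1%:R^-1 <= sup D by apply: ub_le_sup => //; case: D_sup.
  by rewrite gerDl leNgt n0.
apply: negligibleS (negligible_bigcup N0) => x /= Tx.
apply: contrapT => xN; apply: Tx; apply/eqP; rewrite eq_le; apply/andP; split.
- rewrite leNgt; apply/negP => sT; apply: xN.
  have e0 : 0 < T x - sup D by rewrite subr_gt0.
  exists (Num.truncn (T x - sup D)^-1) => //; right => /=; apply/negP.
  rewrite -leNgt -lerBrDl -[leRHS]invrK lef_pV2 ?posrE ?invr_gt0 //.
  exact/ltW/truncnS_gt.
- rewrite leNgt; apply/negP => sT; apply: xN.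
  have e0 : 0 < sup D - T x by rewrite subr_gt0.
  exists (Num.truncn (sup D - T x)^-1) => //; left => /=.
  rewrite ltrBrDr -ltrBrDl -[ltRHS]invrK ltf_pV2 ?posrE ?invr_gt0 //.
  exact: truncnS_gt.
Qed.

Context d' (Y : measurableType d').
Variables (mu : {sigma_finite_measure set X -> \bar R}).
Variable nu : {sigma_finite_measure set Y -> \bar R}.

Lemma product_null (N : set (X * Y)) : measurable N ->
  {ae mu, forall x, nu (xsection N x) = 0%E} <-> (mu \x nu)%E N = 0%E.
Proof.
move=> mN; have mnu : measurable_fun setT (nu \o xsection N).
  exact: measurable_fun_xsection.
split=> [H|H].
  rewrite /product_measure1 /=.
  rewrite (ae_eq_integral (cst 0%E)) ?integral0 //.
  by apply: filterS H.
have : ae_eq mu setT (nu \o xsection N) (cst 0%E).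
  apply/(ae_eq_integral_abs mu measurableT mnu).
  by under eq_integral do rewrite gee0_abs //.
by apply: filterS => x; apply.
Qed.

Lemma ae_product (P : X * Y -> Prop) :
  {ae (mu \x nu)%E, forall p, P p} ->
  {ae mu, forall x, {ae nu, forall y, P (x, y)}}.
Proof.
move=> [N [mN N0 PN]]; have := (product_null mN).2 N0.
apply: filterS => x Nx; exists (xsection N x); split => //.
  exact: measurable_xsection.
by move=> y /= nP; rewrite /xsection /= inE; apply: PN.
Qed.

Lemma ae_product_fst (P : X -> Prop) :
  {ae mu, forall x, P x} -> {ae (mu \x nu)%E, forall p, P p.1}.
Proof.
move=> [N [mN N0 PN]]; exists (N `*` setT); split.
- exact: measurableX.
- by rewrite product_measure1E // (_ : _ N = 0%E) ?mul0e.
- by move=> [x y] /= nP; split => //; exact: PN.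
Qed.

End almost_everywhere.

(** * Borel functions to the complex numbers *)

Section complex_borel.
Context (R : realType) d (X : measurableType d).

Lemma complex_borel_parts (f : X -> R[i]) :
  measurable_fun [set: X] (f : X -> g_sigma_algebraType (@open R[i])) ->
  measurable_fun [set: X] (fun x => Re (f x)) /\
  measurable_fun [set: X] (fun x => Im (f x)).
Proof.
move=> mf; have part (p : R[i] -> R) : continuous p ->
    measurable_fun [set: X] (fun x => p (f x)).
  move=> cp; apply: (measurability _ (RGenOInfty.measurableE R)) => _ [_ [y ->] <-].
  have op : open (p @^-1` `]y, +oo[) by apply: open_comp_preimage => //; exact: interval_open.
  exact: (mf measurableT _ (@sub_sigma_algebra _ setT (@open R[i]) _ op)).
by split; apply: part; [exact: Re_continuous|exact: Im_continuous].
Qed.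

(** Every open set of the plane is a countable union of discs with rational
    centres and radii of square [n.+1%:R^-1]. *)
Lemma complex_borel_of_parts (f : X -> R[i]) : cbmeas f ->
  measurable_fun [set: X] (f : X -> g_sigma_algebraType (@open R[i])).
Proof.
move=> bf.
have mdisc (q : R[i]) (r : R) : measurable [set x | sqmod (f x - q) < r].
  have [mq _] := bmeas_sqmod (cbmeasB bf (@cbmeas_cst R _ X q)).
  have -> : [set x | sqmod (f x - q) < r] =
      [set: X] `&` (fun x => sqmod (f x - q)) @^-1` `]-oo, r[.
    by rewrite setTI; apply/seteqP; split => x; rewrite /= in_itv.
  exact: mq.
apply: (@measurability _ _ X (g_sigma_algebraType (@open R[i])) _ _ (@open R[i])) => //.
move=> _ [U oU <-]; rewrite setTI.
pose q (p : rat * rat) : R[i] := ratr p.1 +i* ratr p.2.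
pose r n : R := n.+1%:R^-1.
have -> : f @^-1` U = \bigcup_(pn : (rat * rat) * nat)
    (if pselect (forall z, sqmod (z - q pn.1) < r pn.2 -> U z)
     then [set x | sqmod (f x - q pn.1) < r pn.2] else set0).
  apply/seteqP; split => [x /= Ux|x [[p n] _] /=]; last first.
    by case: pselect => // pnU /pnU.
  have : nbhs (f x) U by exact: open_nbhs_nbhs.
  move=> /(@nbhs_ballP _ R[i]^o)[e /= e0 eU].
  have [s s0 se] : exists2 s : R, 0 < s & s%:C = e.
    exists (Re e); first by move: e0; rewrite ltcE => /andP[].
    by rewrite RRe_real // gtr0_real.
  have fU z : sqmod (f x - z) < s ^+ 2 -> U z.
    by move=> xz; apply: eU; rewrite /ball /= -se ltc_sqmod // ltW.
  have s2 : 0 < s ^+ 2 / 4 by rewrite divr_gt0 // exprn_gt0.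
  pose n := Num.truncn (s ^+ 2 / 4)^-1.
  have rn : r n < s ^+ 2 / 4.
    rewrite /r -[ltRHS]invrK ltf_pV2 ?posrE ?invr_gt0 //; exact: truncnS_gt.
  have r0 : 0 < r n by rewrite invr_gt0.
  pose t := Num.min 1 (r n / 4).
  have t0 : 0 < t by rewrite lt_min ltr01 divr_gt0.
  have t1 : t <= 1 by rewrite ge_min lexx.
  have tr : t <= r n / 4 by rewrite ge_min lexx orbT.
  have near_rat (y : R) : exists p : rat, (y - ratr p) ^+ 2 <= r n / 4.
    have yt : y < y + t by rewrite ltrDl.
    have [p] := rat_in_itvoo yt; rewrite in_itv /= => /andP[yp pt].
    by exists p; nra.
  have [p1 P1] := near_rat (Re (f x)); have [p2 P2] := near_rat (Im (f x)).
  have fq : sqmod (f x - q (p1, p2)) < r n.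
    by rewrite /sqmod !ReImE /=; lra.
  exists ((p1, p2), n) => //=; case: pselect => [//|[]] z zq; apply: fU.
  have -> : f x - z = (f x - q (p1, p2)) + (q (p1, p2) - z) by ring.
  have := sqmodD_le (f x - q (p1, p2)) (q (p1, p2) - z).
  rewrite [sqmod (q _ - z)]sqmodB; lra.
apply: countable_bigcupT_measurable => // pn.
case: pselect => H; [exact: mdisc|exact: measurable0].
Qed.

End complex_borel.

(** * Skew products *)

Section skew_products.
Variables (R : realType) (d : measure_display) (X : measurableType d).
Variable mu : {sigma_finite_measure set X -> \bar R}.
Variable K : topologicalZmodType.
Variable nu : {finite_measure set (borel_group K) -> \bar R}.
Variables (Gamma : groupType) (alpha : Gamma -> X -> X) (beta : Gamma -> K -> K).
Variable c : Gamma -> X -> K.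
Hypothesis mu_neq0 : mu [set: X] != 0%E.
Hypothesis K_sc : @second_countable K.
Hypothesis nu_haar : haar_measure nu.
Hypothesis alpha_mp : mp_action mu alpha.
Hypothesis beta_aut : automorphism_action beta.
Hypothesis c_cocycle : beta_cocycle alpha beta c mu.
Local Notation Y := (borel_group K).
Local Notation bm u := (cbmeas (u : borel_group K -> _)).
Implicit Types (chi omega : K -> R[i]) (g h : Gamma).

Let nu_neq0 : nu [set: Y] != 0%E := nu_haar.1.

Lemma alpha_ae g (P : X -> Prop) :
  {ae mu, forall x, P x} -> {ae mu, forall x, P (alpha g x)}.
Proof.
have [_ malpha alphamu] := alpha_mp.
by apply: ae_preserving; [exact: malpha|move=> A mA; exact: alphamu].
Qed.

Lemma betaK g : cancel (beta g^-1%g) (beta g).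
Proof. by have [[b1 bM] _ _] := beta_aut; move=> k; rewrite -bM mulgV b1. Qed.

Lemma betaVK g : cancel (beta g) (beta g^-1%g).
Proof. by have [[b1 bM] _ _] := beta_aut; move=> k; rewrite -bM mulVg b1. Qed.

Lemma dual_comp g chi : pontryagin_dual chi -> pontryagin_dual (fun k => chi (beta g k)).
Proof.
have [_ bc bD] := beta_aut.
move=> [cchi chi1 chiM]; split => [k|k|k l] //.
  by apply: continuous_comp; [exact: bc|exact: cchi].
by rewrite bD chiM.
Qed.

Lemma stabilizer_comp g chi : dual_stabilizer beta chi g ->
  (fun k => chi (beta g k)) = chi.
Proof.
move=> sg; apply/funext => k.
by rewrite -[in LHS]sg /dual_action betaVK.
Qed.

Lemma orbit_dual chi omega : pontryagin_dual chi -> dual_orbit beta chi omega ->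
  pontryagin_dual omega.
Proof. by move=> dchi [g _ <-]; exact: dual_comp. Qed.

Lemma orbit_comp chi omega g : dual_orbit beta chi omega ->
  dual_orbit beta chi (fun k => omega (beta g k)).
Proof.
have [[_ bM] _ _] := beta_aut.
move=> [h _ <-]; exists (g^-1 * h)%g => //; apply/funext => k.
by rewrite /dual_action invgM invgK bM.
Qed.

Lemma orbit_refl chi : dual_orbit beta chi chi.
Proof.
have [[b1 _] _ _] := beta_aut.
by exists 1%g => //; apply/funext => k; rewrite /dual_action invg1 b1.
Qed.

Lemma cocycle_cbmeas chi g : pontryagin_dual chi -> cbmeas (fun x => chi (c g x)).
Proof. by move=> dchi; exact: (cbmeas_comp (c_cocycle.1 g) (dual_bm dchi)). Qed.

Section set_coefficients.
Variable A : set (X * Y).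
Hypothesis mA : measurable A.

Definition section_fun (x : X) : K -> R[i] := fun k => (\1_A (x, k))%:C.

Definition coef chi (x : X) : R[i] := fourier nu (section_fun x) chi.

Lemma bm_section_fun x : bm (section_fun x).
Proof.
have bA : bmeas (\1_A : X * Y -> R) by exact: bmeas_indic.
exact: (cbmeas_section x (cbmeas_real bA)).
Qed.

Lemma cbmeas_coef chi : pontryagin_dual chi -> cbmeas (coef chi).
Proof.
move=> dchi; apply: (cbmeas_mean nu_neq0
  (F := fun p : X * Y => (\1_A p)%:C * (chi p.2)^*%C)).
apply: cbmeasM; first by apply: cbmeas_real; exact: bmeas_indic.
by apply: cbmeasJ; exact: (cbmeas_comp measurable_snd (dual_bm dchi)).
Qed.

(** The substitution [k |-> c g x + beta g k] preserves the Haar measure, and on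
    almost every fibre it carries the fibre of [A] over [x] to the one over
    [alpha g x]. *)
Lemma coef_equivariance chi g : pontryagin_dual chi ->
  {ae (mu \x nu)%E, forall p, A (skew_product alpha beta c g p) <-> A p} ->
  {ae mu, forall x, coef chi (alpha g x) =
    (chi (c g x))^*%C * coef (fun k => chi (beta g k)) x}.
Proof.
move=> dchi /ae_product; apply: filterS => x Ax.
have [_ bc bD] := beta_aut; have [_ chi1 chiM] := dchi.
have bs := bm_section_fun (alpha g x).
have bchiJ : bm (fun k => (chi k)^*%C) by apply: cbmeasJ; exact: dual_bm.
have bu := bmM bs bchiJ.
have bt := bm_translate (c g x) bu.
rewrite /coef /fourier -(mean_translate nu_haar (c g x) bu).
rewrite -(mean_automorphism K_sc nu_haar (bc g) (bD g) (@betaK g) bt).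
have bchig : bm (fun k => (chi (beta g k))^*%C).
  by apply: cbmeasJ; apply: dual_bm; exact: dual_comp.
have bx := bmM (bm_section_fun x) bchig.
rewrite -(meanZ nu _ bx); apply: mean_ae.
- exact: (cbmeas_comp (continuous_borel (bc g)) bt).
- exact: bmZ.
apply: filterS Ax => k Axk.
rewrite chiM conjcM /section_fun.
have -> : \1_A (alpha g x, c g x + beta g k) = \1_A (x, k) :> R.
  rewrite !indicE; congr (nat_of_bool _)%:R.
  by apply/idP/idP; rewrite !inE => /Axk.
ring.
Qed.

(** On the stabiliser the coefficient satisfies
    [coef chi (alpha g x) = conj (chi (c g x)) * coef chi x], so its conjugate,
    scaled to modulus 1, trivialises the induced cocycle; the value 1 is used on
    the null set where the modulus is not the generic one. *)
Lemma coboundary_of_coef chi (C : R) : pontryagin_dual chi -> 0 < C ->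
  {ae mu, forall x, sqmod (coef chi x) = C} ->
  (forall g, {ae mu, forall x, coef chi (alpha g x) =
    (chi (c g x))^*%C * coef (fun k => chi (beta g k)) x}) ->
  coboundary mu alpha (dual_stabilizer beta chi) (induced_cocycle c chi).
Proof.
move=> dchi C0 TC eqv; have bcoef := cbmeas_coef dchi.
pose E : set X := [set x | sqmod (coef chi x) = C].
have mE : measurable E.
  have [mT _] := bmeas_sqmod bcoef.
  have -> : E = [set: X] `&` (fun x => sqmod (coef chi x)) @^-1` [set C] by rewrite setTI.
  exact: mT.
pose s : R[i] := ((Num.sqrt C)^-1)%:C.
have ss : sqmod s * C = 1.
  rewrite /sqmod /s /= expr0n addr0 exprVn sqr_sqrtr ?(ltW C0) //.
  by rewrite mulVf // gt_eqF.
pose f x : R[i] := (\1_E x)%:C * (s * (coef chi x)^*%C) + (1 - (\1_E x)%:C).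
have fE x : E x -> f x = s * (coef chi x)^*%C.
  by move=> Ex; rewrite /f indicE mem_set // mul1r subrr addr0.
have fCE x : ~ E x -> f x = 1.
  by move=> Ex; rewrite /f indicE memNset // mul0r subr0 add0r.
have f1 x : sqmod (f x) = 1.
  have [Ex|Ex] := pselect (E x); last by rewrite fCE // sqmod1.
  by rewrite fE // sqmodM sqmodJ Ex.
have bf : cbmeas f.
  have bI : bmeas (\1_E : X -> R) by exact: bmeas_indic.
  have bE : cbmeas (fun x => (\1_E x)%:C) := cbmeas_real bI.
  apply: cbmeasD; first apply: cbmeasM => //.
    by apply: cbmeasM; [exact: cbmeas_cst|exact: cbmeasJ].
  by apply: cbmeasB => //; exact: cbmeas_cst.
exists f; split.
- exact: complex_borel_of_parts.
- by move=> x; apply/sqmod_normP; rewrite f1.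
move=> g sg; have := alpha_ae g TC; have := eqv g; rewrite (stabilizer_comp sg).
apply: filterS3 TC => x Tx eqx Tgx; rewrite (fE _ Tx) (fE _ Tgx) eqx conjcM conjcK.
have f0 : s * (coef chi x)^*%C != 0.
  by rewrite -(fE _ Tx) -sqmod_eq0 f1 oner_eq0.
by rewrite [s * (_ * _)]mulrCA mulfK.
Qed.

End set_coefficients.

(** The coefficients of an invariant set at all nontrivial characters vanish
    almost everywhere, so almost all of its fibres are null or conull; the
    squared coefficient at the trivial character is the squared measure of the
    fibre, and it is constant. *)
Theorem ergodic_of_no_coboundary : countable [set: Gamma] ->
  (forall chi : K -> R[i], pontryagin_dual chi ->
     ergodic mu alpha (dual_stabilizer beta chi)) ->
  (forall chi : K -> R[i], pontryagin_dual chi -> chi <> (fun=> 1) ->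
     finite_set (dual_orbit beta chi) ->
     ~ coboundary mu alpha (dual_stabilizer beta chi) (induced_cocycle c chi)) ->
  ergodic (mu \x nu)%E (skew_product alpha beta c) [set: Gamma].
Proof.
move=> Gc stab_erg nocob A mA Ainv.
have eqv chi g : pontryagin_dual chi -> {ae mu, forall x, coef A chi (alpha g x) =
    (chi (c g x))^*%C * coef A (fun k => chi (beta g k)) x}.
  by move=> dchi; apply: coef_equivariance => //; exact: Ainv.
pose T chi x := sqmod (coef A chi x).
have Teq chi g : pontryagin_dual chi ->
    {ae mu, forall x, T chi (alpha g x) = T (fun k => chi (beta g k)) x}.
  move=> dchi; apply: filterS (eqv chi g dchi) => x; rewrite /T => ->.
  have [_ chi1 _] := dchi.
  by rewrite sqmodM sqmodJ; have /sqmod_normP/eqP -> := chi1 (c g x); rewrite mul1r.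
have Tconst chi : pontryagin_dual chi -> exists C, {ae mu, forall x, T chi x = C}.
  move=> dchi; apply: (ergodic_constant mu_neq0 (stab_erg chi dchi)).
    exact/bmeas_sqmod/(cbmeas_coef mA dchi).
  by move=> g sg; have := Teq chi g dchi; rewrite (stabilizer_comp sg).
have coef0 chi : pontryagin_dual chi -> chi <> (fun=> 1) ->
    {ae mu, forall x, coef A chi x = 0}.
  move=> dchi nchi; have [C TC] := Tconst chi dchi.
  have [C_eq0|C_neq0] := eqVneq C 0.
    apply: filterS TC => x; rewrite C_eq0 => /eqP.
    by rewrite sqmod_eq0 => /eqP.
  have C0 : 0 < C.
    have [x Tx] := ae_exists mu_neq0 TC.
    by rewrite lt_neqAle eq_sym C_neq0 -Tx sqmod_ge0.
  exfalso; have [finO|infO] := pselect (finite_set (dual_orbit beta chi)).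
    apply: (nocob chi dchi nchi finO).
    by apply: (coboundary_of_coef mA dchi C0 TC) => g; exact: eqv.
  have cO : countable (dual_orbit beta chi).
    by apply: sub_countable Gc; exact: card_image_le.
  have TO omega : dual_orbit beta chi omega -> {ae mu, forall x, T omega x = C}.
    move=> [g _ <-]; have := Teq chi g^-1%g dchi.
    by apply: filterS2 (alpha_ae g^-1%g TC) => x -> <-.
  have [x Tx] := ae_exists mu_neq0 (ae_countable cO TO).
  apply: infO; apply: (bessel_finite nu_haar (bm_section_fun mA x) C0).
    by move=> omega; exact: orbit_dual.
  by move=> omega Oomega; rewrite -(Tx _ Oomega).
have sec : {ae mu, forall x, nu (xsection A x) = 0%E \/ nu (~` xsection A x) = 0%E}.
  have cD : countable [set chi : K -> R[i] | pontryagin_dual chi /\ chi <> (fun=> 1)].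
    apply: sub_countable (countable_dual K_sc nu_haar).
    by apply: subset_card_le => chi [].
  have := ae_countable cD (fun chi dchi => coef0 chi dchi.1 dchi.2).
  apply: filterS => x coefx.
  have mAx : measurable (xsection A x : set Y) by exact: measurable_xsection.
  have [|/eqP Ax0] := eqVneq (nu (xsection A x)) 0%E; first by left.
  have [|/eqP CAx0] := eqVneq (nu (~` xsection A x)) 0%E; first by right.
  have [chi dchi] := character_of_set K_sc nu_haar mAx (introN eqP Ax0) (introN eqP CAx0).
  move=> /eqP[]; rewrite -[RHS](coefx chi dchi); congr mean; apply/funext => k.
  by rewrite /section_fun !indicE mem_xsection.
have d1 : pontryagin_dual ((fun=> 1) : K -> R[i]).
  by split => [k|k|k l]; [exact: cvg_cst|exact: normr1|rewrite mulr1].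
have [C TC] := Tconst _ d1.
have T1 x : T (fun=> 1) x = rmean nu (\1_(xsection A x) : Y -> R) ^+ 2.
  have -> : T (fun=> 1) x = sqmod (rmean nu (\1_(xsection A x) : Y -> R))%:C.
    rewrite -mean_real; congr (sqmod (mean nu _)); apply/funext => k.
    by rewrite conjc1 mulr1 /section_fun !indicE mem_xsection.
  by rewrite /sqmod /= expr0n addr0.
have T0 x : T (fun=> 1) x = 0 <-> nu (xsection A x) = 0%E.
  have mAx : measurable (xsection A x : set Y) by exact: measurable_xsection.
  rewrite T1 rmean_indic //; split => [/eqP|->]; last by rewrite mul0r expr0n.
  rewrite expf_eq0 /= mulf_eq0 invr_eq0 (gt_eqF (nuT_gt0 nu_neq0)) orbF => /eqP A0.
  by rewrite -[LHS]fineK ?fin_num_measure // A0.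
have [C0|C0] := eqVneq C 0; [left|right].
  apply/(product_null mu nu mA); apply: filterS TC => x.
  by rewrite C0 => /T0.
apply/(product_null mu nu (measurableC mA)); apply: filterS2 sec TC => x + TxC.
have -> : xsection (~` A) x = ~` xsection A x.
  by apply/seteqP; split => k; rewrite /xsection /= !inE.
move=> -[/T0|//].
by rewrite TxC => C_eq0; move: C0; rewrite C_eq0 eqxx.
Qed.

(** If [f] trivialises the cocycle of [chi], then [conj (f x) * chi k] is
    invariant under the stabiliser of [chi]. Its translate by [g^-1] depends only
    on the character [omega] that [g] carries [chi] to, and is
    [a omega x * omega k]; the sum of these translates over the orbit is the
    invariant function [S]. *)
Theorem no_coboundary_of_ergodic :
  ergodic (mu \x nu)%E (skew_product alpha beta c) [set: Gamma] ->
  forall chi : K -> R[i], pontryagin_dual chi -> chi <> (fun=> 1) ->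
    finite_set (dual_orbit beta chi) ->
    ~ coboundary mu alpha (dual_stabilizer beta chi) (induced_cocycle c chi).
Proof.
move=> erg chi dchi nchi finO [f [mf f1 fcob]].
have [[_ alM] mal _] := alpha_mp; have [[_ bM] _ _] := beta_aut.
have [_ chi1 chiM] := dchi.
have bf : cbmeas f by have [] := complex_borel_parts mf; exact: cbmeas_norm1.
have [s us sO] : exists2 s : seq (K -> R[i]), uniq s &
    forall omega, omega \in s <-> dual_orbit beta chi omega.
  have /finite_seqP[s0 Os0] := finO.
  exists (undup s0); first exact: undup_uniq.
  by move=> omega; rewrite mem_undup Os0.
have ds omega : omega \in s -> pontryagin_dual omega.
  by move=> /sO; exact: orbit_dual.
have [sel selP] : exists sel : (K -> R[i]) -> Gamma,
    forall omega, dual_orbit beta chi omega -> dual_action beta (sel omega) chi = omega.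
  suff /choice[sel selP] : forall omega, exists g,
      dual_orbit beta chi omega -> dual_action beta g chi = omega by exists sel.
  move=> omega; have [[g _ <-]|nO] := pselect (dual_orbit beta chi omega).
    by exists g.
  by exists 1%g.
pose a omega x := (f (alpha (sel omega)^-1%g x))^*%C * chi (c (sel omega)^-1%g x).
have a1 omega x : sqmod (a omega x) = 1.
  rewrite /a sqmodM sqmodJ.
  have /sqmod_normP/eqP -> := f1 (alpha (sel omega)^-1%g x).
  by have /sqmod_normP/eqP -> := chi1 (c (sel omega)^-1%g x); rewrite mulr1.
have ba omega : cbmeas (a omega).
  apply: cbmeasM; last exact: cocycle_cbmeas.
  by apply: cbmeasJ; exact: (cbmeas_comp (mal _) bf).
(* The invariance of S, one summand at a time: the map (x, k) |-> rho g (x, k)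
   turns the summand at omega into the summand at omega o beta g. *)
have key g omega : dual_orbit beta chi omega -> {ae mu, forall x,
    a omega (alpha g x) * omega (c g x) = a (fun k => omega (beta g k)) x}.
  move=> Oomega; have Oomegag := orbit_comp g Oomega.
  pose omegag : K -> R[i] := fun k => omega (beta g k).
  rewrite -/omegag.
  pose p := sel omega; pose t := sel omegag; pose h := (p^-1 * g * t)%g.
  have Hp k : chi (beta p^-1%g k) = omega k by rewrite -[in RHS](selP _ Oomega).
  have Ht k : chi (beta t^-1%g k) = omega (beta g k).
    by have := congr1 (@^~ k) (selP _ Oomegag).
  have sh : dual_stabilizer beta chi h.
    apply/funext => k; rewrite /dual_action /h !invgM invgK !bM Ht betaK.
    by rewrite -Hp betaVK.
  have htE : (h * t^-1 = p^-1 * g)%g by rewrite /h mulgK.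
  have := c_cocycle.2 g p^-1%g.
  have := c_cocycle.2 t^-1%g h.
  have := alpha_ae t^-1%g (fcob h sh).
  apply: filterS3 => x; rewrite /induced_cocycle htE => fx c2 c1.
  have chih k : chi (beta h k) = chi k.
    exact: (congr1 (@^~ k) (stabilizer_comp sh)).
  rewrite /a -/p -/t -Hp -mulrA -chiM c1 -c2 chiM chih -alM -htE alM.
  have fy0 : f (alpha t^-1%g x) != 0 by rewrite -normr_gt0 f1.
  have -> : f (alpha h (alpha t^-1%g x)) =
      chi (c h (alpha t^-1%g x)) * f (alpha t^-1%g x) by rewrite fx mulfVK.
  rewrite conjcM; have := mulJ1 (chi1 (c h (alpha t^-1%g x))).
  move: (chi _) (chi _) (f _) => w z v zz.
  transitivity ((z * z^*%C) * (v^*%C * w)); first by ring.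
  by rewrite zz mul1r.
pose S (p : X * Y) : R[i] := \sum_(omega <- s) a omega p.1 * omega p.2.
have bS : cbmeas S.
  apply: cbmeas_sum => omega somega; apply: cbmeasM.
    exact: (cbmeas_comp measurable_fst (ba omega)).
  exact: (cbmeas_comp measurable_snd (dual_bm (ds _ somega))).
have Sinv g : {ae (mu \x nu)%E, forall p, S (skew_product alpha beta c g p) = S p}.
  have := ae_countable (finite_set_countable finO) (fun omega => @key g omega).
  move/(ae_product_fst nu); apply: filterS => -[x k] /= keyx.
  rewrite /S /=.
  pose bg omega := fun k => omega (beta g k) : R[i].
  have bg_inj : injective bg.
    move=> u v uv; apply/funext => l; have := congr1 (@^~ (beta g^-1%g l)) uv.
    by rewrite /bg betaK.
  have sbg : {subset map bg s <= s}.
    by move=> _ /mapP[omega /sO somega ->]; apply/sO; exact: orbit_comp.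
  have umap : uniq (map bg s) by rewrite map_inj_uniq.
  have [_ memE] := uniq_min_size umap sbg (eq_leq (esym (size_map bg s))).
  rewrite -[RHS](perm_big _ (uniq_perm umap us memE)) big_map /=.
  rewrite [LHS]big_seq [RHS]big_seq; apply: eq_bigr => omega somega.
  have [_ _ omegaM] := ds _ somega.
  by rewrite omegaM mulrA keyx //; exact/sO.
have mn0 : (mu \x nu)%E [set: X * Y] != 0%E.
  by rewrite -setXTT product_measure1E // mule_eq0 negb_or mu_neq0.
have [C1 SC1] := ergodic_constant mn0 erg bS.1 (fun g _ => filterS
  (fun p Sp => congr1 (@complex.Re R) Sp) (Sinv g)).
have [C2 SC2] := ergodic_constant mn0 erg bS.2 (fun g _ => filterS
  (fun p Sp => congr1 (@complex.Im R) Sp) (Sinv g)).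
have SC : {ae (mu \x nu)%E, forall p, S p = C1 +i* C2}.
  by apply: filterS2 SC1 SC2 => p Sp1 Sp2; exact: complex_ext.
have [x Sx] := ae_exists mu_neq0 (ae_product SC).
have bchiJ : bm (fun k => (chi k)^*%C) by apply: cbmeasJ; exact: dual_bm.
have Schi0 : mean nu (fun k => S (x, k) * (chi k)^*%C) = 0.
  have bSx : bm (fun k => S (x, k)) by exact: (cbmeas_section x bS).
  have -> : mean nu (fun k => S (x, k) * (chi k)^*%C) =
      mean nu (fun k => (C1 +i* C2) * (chi k)^*%C).
    apply: mean_ae; [exact: (bmM bSx bchiJ)|exact: (bmZ _ bchiJ)|].
    by apply: filterS Sx => k /= ->.
  rewrite (meanZ nu _ bchiJ) (meanJ nu (dual_bm dchi)).
  by rewrite (mean_character nu_haar dchi nchi) conjc0 mulr0.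
have schi : chi \in s by apply/sO; exact: orbit_refl.
have := a1 chi x; suff -> : a chi x = 0 by rewrite sqmod0 => /esym/eqP; rewrite oner_eq0.
rewrite -Schi0.
have -> : (fun k => S (x, k) * (chi k)^*%C) =
    fun k => \sum_(omega <- s) a omega x * (omega k * (chi k)^*%C).
  by apply/funext => k; rewrite /S mulr_suml; apply: eq_bigr => omega _; rewrite mulrA.
have bo omega : omega \in s -> bm (fun k => omega k * (chi k)^*%C).
  by move=> somega; exact: (bmM (dual_bm (ds _ somega)) bchiJ).
rewrite mean_sum; last by move=> omega /bo; exact: bmZ.
rewrite (bigD1_seq chi) //= (meanZ nu _ (bo _ schi)) (character_sqnorm nu_haar dchi).
rewrite mulr1 big1_seq ?addr0 // => omega /andP[omegachi somega].
rewrite (meanZ nu _ (bo _ somega)).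
rewrite (character_orthogonality nu_haar (ds _ somega) dchi) ?mulr0 //.
exact/eqP.
Qed.

End skew_products.

Unset Implicit Arguments.
Set Strict Implicit.

Theorem proposition5p2 (R : realType)
    (d : measure_display) (X : measurableType d)
    (mu : {sigma_finite_measure set X -> \bar R})
    (K : topologicalZmodType)
    (nu : {finite_measure set (borel_group K) -> \bar R})
    (Gamma : groupType)
    (alpha : Gamma -> X -> X) (beta : Gamma -> K -> K) (c : Gamma -> X -> K)
    (X_standard : standard_borel R X)
    (mu_neq0 : mu [set: X] != 0%E)
    (K_compact : compact [set: K])
    (K_hausdorff : hausdorff_space K)
    (K_second_countable : @second_countable K)
    (nu_haar : haar_measure nu)
    (Gamma_countable : countable [set: Gamma])
    (alpha_mp : mp_action mu alpha)
    (beta_aut : automorphism_action beta)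
    (c_cocycle : beta_cocycle alpha beta c mu)
    (stab_ergodic : forall chi : K -> R[i], pontryagin_dual chi ->
       ergodic mu alpha (dual_stabilizer beta chi)) :
  ergodic (mu \x nu)%E (skew_product alpha beta c) [set: Gamma]
  <->
  (forall chi : K -> R[i], pontryagin_dual chi ->
     chi <> (fun=> 1) ->
     finite_set (dual_orbit beta chi) ->
     ~ coboundary mu alpha (dual_stabilizer beta chi)
         (induced_cocycle c chi)).
Proof.
split; first exact: no_coboundary_of_ergodic.
exact: ergodic_of_no_coboundary.
Qed.
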